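(* Let $\Omega\subset\mathbb{R}^2$ be an open and bounded domain with Lipschitz boundary, $\emptyset\neq\mathcal{D}\subset\Omega$ a finite ordered set with $\ell=\#\mathcal{D}$, $\nu>0$, $\eta>0$, $\mathbf{y}_\Omega\in\mathbf{L}^2(\Omega)$, $\alpha\in(0,2)$, and $\mathbf{a}_t<\mathbf{b}_t$ in $\mathbb{R}^2$ for $t\in\mathcal{D}$. Let $(\bar{\mathbf{y}},\bar p)$, $(\bar{\mathbf{z}},\bar r)$ and $\bar{\mathcal{U}}\in\mathbb{U}_{ad}$ satisfy the first order optimality conditions, i.e. $(\bar{\mathbf{y}},\bar p)$ is a weak solution of the state equation associated to $\bar{\mathcal{U}}$, $(\bar{\mathbf{z}},\bar r)$ solves the adjoint problem associated to $\bar{\mathbf{y}}$, and $$\sum_{t\in\mathcal{D}}(\bar{\mathbf{z}}(t)+\eta\bar{\mathbf{u}}_t)\cdot(\mathbf{u}_t-\bar{\mathbf{u}}_t)\ge0\qquad\forall\,\mathcal{U}=(\mathbf{u}_1,\dots,\mathbf{u}_\ell)\in\mathbb{U}_{ad},$$ and let $\bar{\mathbf{y}}$ be regular. Then the condition $$j''(\bar{\mathcal{U}})\mathcal{V}^2>0\qquad\forall\,\mathcal{V}\in\mathbf{C}_{\bar{\mathcal{U}}}\setminus\{\mathbf{0}\}$$ is equivalent to $$\exists\,\kappa,\tau>0:\quad j''(\bar{\mathcal{U}})\mathcal{V}^2\ge\kappa\|\mathcal{V}\|^2_{[\mathbb{R}^2]^\ell}\qquad\forall\,\mathcal{V}\i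n\mathbf{C}^\tau_{\bar{\mathcal{U}}}.$$
   Context: Controls: $\mathcal{U}=(\mathbf{u}_1,\dots,\mathbf{u}_\ell)\in[\mathbb{R}^2]^\ell$, components indexed by $t\in\mathcal{D}$; $\mathbb{U}_{ad}=\{\mathcal{V}\in[\mathbb{R}^2]^\ell:\mathbf{a}_t\le\mathbf{v}_t\le\mathbf{b}_t\ \forall t\in\mathcal{D}\}$ (componentwise). Cost: $J(\mathbf{y},\mathcal{U})=\frac12\|\mathbf{y}-\mathbf{y}_\Omega\|_{\mathbf{L}^2(\Omega)}^2+\frac{\eta}{2}\sum_{t\in\mathcal{D}}|\mathbf{u}_t|^2$. Weight: let $d_{\mathcal{D}}=\mathrm{dist}(\mathcal{D},\partial\Omega)$ if $\ell=1$ and $d_{\mathcal{D}}=\min\{\mathrm{dist}(\mathcal{D},\partial\Omega),\min\{|t-t'|:t,t'\in\mathcal{D},t\ne t'\}\}$ otherwise. If $\ell=1$, $\mathcal{D}=\{t\}$, then $\rho(x)=|x-t|^\alpha$; otherwise $\rho(x)=|x-t|^\alpha$ if there is $t\in\mathcal{D}$ with $|x-t|<d_{\mathcal{D}}/2$, and $\rho(x)=1$ if $|x-t|\ge d_{\mathcal{D}}/2$ for all $t\in\mathcal{D}$. Spaces: for a weight $\omega$, $\|f\|_{L^2(\omega,\Omega)}^2=\int_\Omega|f|^2\omega$; $H^1(\omega,\Omega)$ consists of $f\in L^2(\omega,\Omega)$ with weak gradient in $L^2(\omega,\Omega)$, with norm $(\|f\|^2_{L^2(\omega,\Omega)}+\|\nabla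 f\|^2_{L^2(\omega,\Omega)})^{1/2}$; $H_0^1(\omega,\Omega)$ is the closure of $C_0^\infty(\Omega)$ in it. Bold letters denote $\mathbb{R}^2$-valued versions; $/\mathbb{R}$ is the quotient by constants. $\mathbf{V}(\rho,\Omega)=\{\mathbf{v}\in\mathbf{H}_0^1(\rho,\Omega):\mathrm{div}\,\mathbf{v}=0\}$. Convention: $(\nabla\mathbf{y})_{ij}=\partial_jy_i$. State equation: a weak solution associated to $\mathcal{U}$ is a pair $(\mathbf{y},p)\in\mathbf{H}_0^1(\rho,\Omega)\times L^2(\rho,\Omega)/\mathbb{R}$ with $\int_{\Omega}(\nu\nabla\mathbf{y}:\nabla\mathbf{v}-\mathbf{y}\otimes\mathbf{y}:\nabla\mathbf{v}-p\,\mathrm{div}\,\mathbf{v})=\sum_{t\in\mathcal{D}}\langle\mathbf{u}_t\delta_t,\mathbf{v}\rangle$ and $\int_\Omega q\,\mathrm{div}\,\mathbf{y}=0$ for all $(\mathbf{v},q)\in\mathbf{H}_0^1(\rho^{-1},\Omega)\times L^2(\rho^{-1},\Omega)/\mathbb{R}$. Here $\langle\mathbf{u}_t\delta_t,\mathbf{v}\rangle=\mathbf{u}_t\cdot\mathbf{v}(t)$ for smooth $\mathbf{v}$, extended by continuity to an element of $\mathbf{H}_0^1(\rho^{-1},\Omega)'$. Regular: the velocity $\mathbf{\Phi}$ of a weak solution associated to a control in $\mathbb{U}_{ad}$ is regular if for every $\mathbf{g}\in\mathbf{H}^{-1}(\Omega)$ the problem of finding $(\boldsymbol\theta,\xi)\in\mathbf{H}_0^1(\Omega)\times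 L^2(\Omega)/\mathbb{R}$ with $\int_\Omega[(\nu\nabla\boldsymbol\theta-\mathbf{\Phi}\otimes\boldsymbol\theta-\boldsymbol\theta\otimes\mathbf{\Phi}):\nabla\mathbf{w}-\xi\,\mathrm{div}\,\mathbf{w}]=\langle\mathbf{g},\mathbf{w}\rangle$, $\int_\Omega s\,\mathrm{div}\,\boldsymbol\theta=0$ for all $(\mathbf{w},s)\in\mathbf{H}_0^1(\Omega)\times L^2(\Omega)/\mathbb{R}$ is well-posed (unique solution depending continuously on $\mathbf{g}$). Local solution map and reduced cost: when $\bar{\mathbf{y}}$ is regular there are open neighborhoods $\mathcal{O}(\bar{\mathcal{U}})\subset[\mathbb{R}^2]^\ell$, $\mathcal{O}(\bar{\mathbf{y}})\subset\mathbf{V}(\rho,\Omega)$, $\mathcal{O}(\bar p)\subset L^2(\rho,\Omega)/\mathbb{R}$ of $\bar{\mathcal{U}},\bar{\mathbf{y}},\bar p$ and a $C^2$ map $Q:\mathcal{O}(\bar{\mathcal{U}})\to\mathcal{O}(\bar{\mathbf{y}})\times\mathcal{O}(\bar p)$ with $Q(\bar{\mathcal{U}})=(\bar{\mathbf{y}},\bar p)$ such that for each $\mathcal{U}\in\mathcal{O}(\bar{\mathcal{U}})$, $Q(\mathcal{U})=(\mathbf{y}_{\mathcal{U}},p_{\mathcal{U}})$ is the unique weak solution associated to $\mathcal{U}$ in $\mathcal{O}(\bar{\mathbf{y}})\times\mathcal{O}(\bar p)$. Define $j:\mathcal{O}(\bar{\mathcal{U}})\to\mathbb{R}$, $j(\mathcal{U})=J(\mathbf{y}_{\mathcal{U}},\mathcal{U})$;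 $j$ is of class $C^2$, and $j''(\bar{\mathcal{U}})\mathcal{V}^2$ denotes its second derivative at $\bar{\mathcal{U}}$ applied to $(\mathcal{V},\mathcal{V})$. Adjoint problem associated to $\bar{\mathbf{y}}$: find $(\bar{\mathbf{z}},\bar r)\in\mathbf{H}_0^1(\rho^{-1},\Omega)\times L^2(\rho^{-1},\Omega)/\mathbb{R}$ with $\int_\Omega(\nu\nabla\bar{\mathbf{z}}:\nabla\mathbf{w}-(\bar{\mathbf{y}}\cdot\nabla)\bar{\mathbf{z}}\cdot\mathbf{w}+(\nabla\bar{\mathbf{y}})^{\intercal}\bar{\mathbf{z}}\cdot\mathbf{w}-\bar r\,\mathrm{div}\,\mathbf{w})=\int_\Omega(\bar{\mathbf{y}}-\mathbf{y}_\Omega)\cdot\mathbf{w}$, $\int_\Omega s\,\mathrm{div}\,\bar{\mathbf{z}}=0$ for all $(\mathbf{w},s)\in\mathbf{H}_0^1(\rho,\Omega)\times L^2(\rho,\Omega)/\mathbb{R}$; one has $\bar{\mathbf{z}}\in\mathbf{C}(\bar\Omega)$. Cones: let $\boldsymbol\Psi_t=\bar{\mathbf{z}}(t)+\eta\bar{\mathbf{u}}_t$ for $t\in\mathcal{D}$. Sign condition (S) on $\mathcal{V}=(\mathbf{v}_1,\dots,\mathbf{v}_\ell)\in[\mathbb{R}^2]^\ell$: for all $t\in\mathcal{D}$, $i\in\{1,2\}$, $(\mathbf{v}_t)_i\ge0$ if $(\bar{\mathbf{u}}_t)_i=(\mathbf{a}_t)_i$ and $(\mathbf{v}_t)_i\le0$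 if $(\bar{\mathbf{u}}_t)_i=(\mathbf{b}_t)_i$. $\mathbf{C}_{\bar{\mathcal{U}}}$ is the set of $\mathcal{V}$ satisfying (S) and, for all $t,i$, $(\boldsymbol\Psi_t)_i\ne0\implies(\mathbf{v}_t)_i=0$. For $\tau>0$, $\mathbf{C}^\tau_{\bar{\mathcal{U}}}$ is the set of $\mathcal{V}$ satisfying (S) and, for all $t,i$, $|(\boldsymbol\Psi_t)_i|>\tau\implies(\mathbf{v}_t)_i=0$. *)

(* Defs.v *)
From HB Require Import structures.
From mathcomp Require Export all_boot all_order all_algebra.
From mathcomp Require Export all_classical all_reals all_analysis.

Set Implicit Arguments.
Unset Strict Implicit.
Unset Printing Implicit Defensive.

Export Order.TTheory GRing.Theory Num.Theory.
Export numFieldNormedType.Exports.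

Global Open Scope classical_set_scope.
Global Open Scope ring_scope.

(** Points of the plane are pairs [x : R * R]; vectors of R^2 (values of vector
    fields, control components) are row vectors ['rV[R]_2].  Elements of the
    Lebesgue and Sobolev spaces are represented by functions on [R * R], which
    are to be read up to equality almost everywhere on the domain; elements of
    L^2(w, Omega)/R are represented by elements of L^2(w, Omega).  All the norms
    below only depend on the classes. *)

Section Plane.
Context {R : realType}.

Definition leb2 :
    {measure set (measurableTypeR R * measurableTypeR R) -> \bar R} :=
  (lebesgue_measure \x lebesgue_measure)%E.

(** Euclidean distance; the norm of the normed module [R * R] is the max norm. *)
Definition edist (x y : R * R) : R :=
  Num.sqrt ((x.1 - y.1) ^+ 2 + (x.2 - y.2) ^+ 2).

Definition dot (u v : 'rV[R]_2) : R := \sum_i u 0 i * v 0 i.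

(** The Frobenius product A : B. *)
Definition frob (A B : 'M[R]_2) : R := \sum_i \sum_j A i j * B i j.

Definition tensor (u v : 'rV[R]_2) : 'M[R]_2 := u^T *m v.

Definition bd (A : set (R * R)) : set (R * R) := closure A `\` A°.

(** Near each boundary point and in suitable orthonormal coordinates, the set is
    the strict epigraph of a Lipschitz function. *)
Definition lipschitz_boundary (A : set (R * R)) : Prop :=
  forall x, bd A x -> exists (r c s : R) (gamma : R -> R),
    [/\ 0 < r, c ^+ 2 + s ^+ 2 = 1, lipschitz gamma
      & forall y, edist y x < r ->
          (A y <-> gamma (c * y.1 + s * y.2) < - s * y.1 + c * y.2)].

Definition std_basis (j : 'I_2) : R * R := if j == 0 then (1, 0) else (0, 1).

Definition partial (j : 'I_2) (f : R * R -> R) : R * R -> R :=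
  fun x => 'D_(std_basis j) f x.

Fixpoint Ck (k : nat) (f : R * R -> R) : Prop :=
  if k is k'.+1 then
    (forall x, differentiable f x) /\ (forall j, Ck k' (partial j f))
  else continuous f.

Definition vcomp (i : 'I_2) (v : R * R -> 'rV[R]_2) : R * R -> R :=
  fun x => v x 0 i.

Section Spaces.
Variable Omega : set (R * R).

(** C_0^oo(Omega). *)
Definition test (phi : R * R -> R) : Prop :=
  [/\ forall k, Ck k phi, compact (closure [set x | phi x != 0])
    & closure [set x | phi x != 0] `<=` Omega].

Definition testv (phi : R * R -> 'rV[R]_2) : Prop := forall i, test (vcomp i phi).

Definition loc_integrable (f : R * R -> R) : Prop :=
  measurable_fun (Omega : set (measurableTypeR R * measurableTypeR R)) f /\
  forall K : set (R * R), K `<=` Omega -> compact K ->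
    leb2.-integrable K (EFin \o f).

Definition is_weak_partial (j : 'I_2) (f g : R * R -> R) : Prop :=
  [/\ loc_integrable f, loc_integrable g
    & forall phi, test phi ->
        \int[leb2]_(x in Omega) (f x * partial j phi x) =
        - \int[leb2]_(x in Omega) (g x * phi x)].

(** A representative of the weak partial derivative (0 if there is none). *)
Definition wpartial (j : 'I_2) (f : R * R -> R) : R * R -> R :=
  xget (fun=> 0) [set g | is_weak_partial j f g].

Definition wgrad (v : R * R -> 'rV[R]_2) (x : R * R) : 'M[R]_2 :=
  \matrix_(i, j) wpartial j (vcomp i v) x.

Definition wdiv (v : R * R -> 'rV[R]_2) (x : R * R) : R := \tr (wgrad v x).

Definition L2 (w f : R * R -> R) : Prop :=
  measurable_fun (Omega : set (measurableTypeR R * measurableTypeR R)) f /\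
  (\int[leb2]_(x in Omega) (f x ^+ 2 * w x)%:E < +oo)%E.

Definition L2v (w : R * R -> R) (v : R * R -> 'rV[R]_2) : Prop :=
  forall i, L2 w (vcomp i v).

Definition L2norm2 (w f : R * R -> R) : R :=
  \int[leb2]_(x in Omega) (f x ^+ 2 * w x).

Definition L2norm (w f : R * R -> R) : R := Num.sqrt (L2norm2 w f).

(** The norm of L^2(w, Omega)/R. *)
Definition L2quot_norm (w f : R * R -> R) : R :=
  inf [set L2norm w (fun x => f x + c) | c in [set: R]].

Definition H1 (w f : R * R -> R) : Prop :=
  L2 w f /\
  forall j, (exists g, is_weak_partial j f g) /\ L2 w (wpartial j f).

Definition H1norm2 (w f : R * R -> R) : R :=
  L2norm2 w f + \sum_j L2norm2 w (wpartial j f).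

Definition H10 (w f : R * R -> R) : Prop :=
  H1 w f /\
  forall e, 0 < e -> exists phi, test phi /\ Num.sqrt (H1norm2 w (f - phi)) < e.

Definition H10v (w : R * R -> R) (v : R * R -> 'rV[R]_2) : Prop :=
  forall i, H10 w (vcomp i v).

Definition H1vnorm (w : R * R -> R) (v : R * R -> 'rV[R]_2) : R :=
  Num.sqrt (\sum_i H1norm2 w (vcomp i v)).

(** The space V(w, Omega) of solenoidal fields of H^1_0(w, Omega). *)
Definition Vdiv (w : R * R -> R) (v : R * R -> 'rV[R]_2) : Prop :=
  H10v w v /\ ae_eq leb2 Omega (wdiv v) (fun=> 0).

Definition eq_mod_const (p q : R * R -> R) : Prop :=
  exists c, ae_eq leb2 Omega p (fun x => q x + c).

(** <u delta_t, v>: the limit of u . phi_n(t) along any sequence of test fields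
    phi_n converging to v in H^1(w, Omega). *)
Definition delta_pairing (w : R * R -> R) (u : 'rV[R]_2) (t : R * R)
    (v : R * R -> 'rV[R]_2) : R :=
  get [set c : R | forall phi : nat -> R * R -> 'rV[R]_2,
    (forall n, testv (phi n)) ->
    H1vnorm w (phi n - v) @[n --> \oo] --> (0 : R) ->
    dot u (phi n t) @[n --> \oo] --> c].

(** H^{-1}(Omega), the dual of H^1_0(Omega); only the values of g on H^1_0(Omega)
    are relevant. *)
Definition Hm1 (g : (R * R -> 'rV[R]_2) -> R) : Prop :=
  (forall c v w, H10v (fun=> 1) v -> H10v (fun=> 1) w ->
     g (c *: v + w) = c * g v + g w) /\
  exists C, forall v, H10v (fun=> 1) v -> `|g v| <= C * H1vnorm (fun=> 1) v.

Definition Hm1norm (g : (R * R -> 'rV[R]_2) -> R) : R :=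
  sup [set `|g v| | v in [set v | H10v (fun=> 1) v /\ H1vnorm (fun=> 1) v <= 1]].

Definition linearized_sol (nu : R) (Phi : R * R -> 'rV[R]_2)
    (g : (R * R -> 'rV[R]_2) -> R) (theta : R * R -> 'rV[R]_2)
    (xi : R * R -> R) : Prop :=
  [/\ H10v (fun=> 1) theta, L2 (fun=> 1) xi
    & forall w s, H10v (fun=> 1) w -> L2 (fun=> 1) s ->
      \int[leb2]_(x in Omega)
         (frob (nu *: wgrad theta x - tensor (Phi x) (theta x)
                - tensor (theta x) (Phi x)) (wgrad w x)
          - xi x * wdiv w x) = g w
      /\ \int[leb2]_(x in Omega) (s x * wdiv theta x) = 0].

(** Well-posedness: existence, uniqueness and continuous dependence. *)
Definition regular (nu : R) (Phi : R * R -> 'rV[R]_2) : Prop :=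
  [/\ forall g, Hm1 g -> exists theta xi, linearized_sol nu Phi g theta xi,
      forall g, Hm1 g -> forall theta xi theta' xi',
        linearized_sol nu Phi g theta xi ->
        linearized_sol nu Phi g theta' xi' ->
        ae_eq leb2 Omega theta theta' /\ eq_mod_const xi xi'
    & forall g, Hm1 g -> forall e, 0 < e -> exists2 d, 0 < d &
        forall g', Hm1 g' -> Hm1norm (g' - g) < d ->
        forall theta xi theta' xi',
          linearized_sol nu Phi g theta xi ->
          linearized_sol nu Phi g' theta' xi' ->
          H1vnorm (fun=> 1) (theta' - theta) < e /\
          L2quot_norm (fun=> 1) (xi' - xi) < e].

End Spaces.

(** [O] is an open subset of the (semi)normed space [(S, N)]. *)
Definition open_in (F : lmodType R) (S : set F) (N : F -> R) (O : set F) : Prop :=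
  O `<=` S /\
  forall f, O f -> exists2 e, 0 < e & forall g, S g -> N (g - f) < e -> O g.

(** [f] is of class C^2 from the open set [O] to the (semi)normed space [(S, N)],
    with derivatives [f1] and [f2].  Differences are measured by [N], so [f]
    takes values in the space of classes of [S] modulo [N]-null elements; the
    values of [f1] and [f2] can be chosen exactly (bi)linear in the directions.
    As the source is finite-dimensional, boundedness of these is automatic. *)
Definition C2 (m n : nat) (F : lmodType R) (S : set F) (N : F -> R)
    (O : set 'M[R]_(m, n)) (f : 'M[R]_(m, n) -> F) : Prop :=
  exists (f1 : 'M[R]_(m, n) -> 'M[R]_(m, n) -> F)
         (f2 : 'M[R]_(m, n) -> 'M[R]_(m, n) -> 'M[R]_(m, n) -> F),
  forall U, O U ->
  [/\ S (f U),
      linear (f1 U) /\ forall W, S (f1 U W),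
      [/\ forall W, linear (f2 U W), forall W, linear (fun W' => f2 U W' W)
        & forall W W', S (f2 U W W')]
    & forall e, 0 < e -> \forall U' \near U,
      [/\ N (f U' - f U - f1 U (U' - U)) <= e * `|U' - U|,
          forall W, N (f1 U' W - f1 U W - f2 U (U' - U) W)
                    <= e * `|U' - U| * `|W|
        & forall W W', N (f2 U' W W' - f2 U W W') <= e * `|W| * `|W'| ]].

Definition second_derivative (m n : nat) (j : 'M[R]_(m, n) -> R)
    (U V W : 'M[R]_(m, n)) : R :=
  'd (fun X => ('d j X : 'M[R]_(m, n) -> R) V) U W.

End Plane.

(** A control is a matrix [U : 'M[R]_(l, 2)] whose row [t] is the component of
    index [t]; [D : 'I_l -> R * R] enumerates the finite ordered set of points. *)
Section ControlProblem.
Context {R : realType}.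
Variables (Omega : set (R * R)) (l : nat) (D : 'I_l -> R * R).

Definition dist_bd : R :=
  inf [set r | exists i x, bd Omega x /\ r = edist (D i) x].

Definition d_D : R :=
  if l == 1%N then dist_bd
  else Num.min dist_bd
         (inf [set r | exists i k, D i <> D k /\ r = edist (D i) (D k)]).

(** The balls of radius [d_D / 2] around the points are disjoint, so at most one
    index can be picked. *)
Definition rho (alpha : R) (x : R * R) : R :=
  if [pick i | (l == 1%N) || (edist x (D i) < d_D / 2)] is Some i
  then edist x (D i) `^ alpha else 1.

(** The value of [rho^-1] at the points of [D], where it should be infinite, is
    irrelevant: it is only used in integrals. *)
Definition rhoV (alpha : R) (x : R * R) : R := (rho alpha x)^-1.

Definition weak_solution (nu alpha : R) (U : 'M[R]_(l, 2))
    (y : R * R -> 'rV[R]_2) (p : R * R -> R) : Prop :=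
  [/\ H10v Omega (rho alpha) y, L2 Omega (rho alpha) p
    & forall v q, H10v Omega (rhoV alpha) v -> L2 Omega (rhoV alpha) q ->
      \int[leb2]_(x in Omega)
         (nu * frob (wgrad Omega y x) (wgrad Omega v x)
          - frob (tensor (y x) (y x)) (wgrad Omega v x)
          - p x * wdiv Omega v x)
        = \sum_t delta_pairing Omega (rhoV alpha) (row t U) (D t) v
      /\ \int[leb2]_(x in Omega) (q x * wdiv Omega y x) = 0].

(** With row vectors, (y . nabla) z is [y *m (wgrad z)^T] and (grad y)^T z is
    [z *m wgrad y], since [wgrad y x i j] is the j-th derivative of [y_i]. *)
Definition adjoint_solution (nu alpha : R) (yO y z : R * R -> 'rV[R]_2)
    (r : R * R -> R) : Prop :=
  [/\ H10v Omega (rhoV alpha) z, L2 Omega (rhoV alpha) r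
    & forall w s, H10v Omega (rho alpha) w -> L2 Omega (rho alpha) s ->
      \int[leb2]_(x in Omega)
         (nu * frob (wgrad Omega z x) (wgrad Omega w x)
          - dot (y x *m (wgrad Omega z x)^T) (w x)
          + dot (z x *m wgrad Omega y x) (w x)
          - r x * wdiv Omega w x)
        = \int[leb2]_(x in Omega) dot (y x - yO x) (w x)
      /\ \int[leb2]_(x in Omega) (s x * wdiv Omega z x) = 0].

Definition cost (eta : R) (yO y : R * R -> 'rV[R]_2) (U : 'M[R]_(l, 2)) : R :=
  2^-1 * (\int[leb2]_(x in Omega) dot (y x - yO x) (y x - yO x))
  + eta / 2 * \sum_t dot (row t U) (row t U).

(** [(Qy, Qp) : OU -> Oy * Op] is a local solution map at [(U, y, p)]. *)
Definition local_solution_map (nu alpha : R) (U : 'M[R]_(l, 2))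
    (y : R * R -> 'rV[R]_2) (p : R * R -> R)
    (OU : set 'M[R]_(l, 2)) (Oy : set (R * R -> 'rV[R]_2))
    (Op : set (R * R -> R))
    (Qy : 'M[R]_(l, 2) -> R * R -> 'rV[R]_2)
    (Qp : 'M[R]_(l, 2) -> R * R -> R) : Prop :=
  [/\ [/\ open OU,
          open_in (Vdiv Omega (rho alpha)) (H1vnorm Omega (rho alpha)) Oy
        & open_in (L2 Omega (rho alpha)) (L2quot_norm Omega (rho alpha)) Op],
      [/\ OU U, Oy y & Op p],
      C2 (Vdiv Omega (rho alpha)) (H1vnorm Omega (rho alpha)) OU Qy /\
      C2 (L2 Omega (rho alpha)) (L2quot_norm Omega (rho alpha)) OU Qp,
      ae_eq leb2 Omega (Qy U) y /\ eq_mod_const Omega (Qp U) p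
    & forall U', OU U' ->
      [/\ Oy (Qy U'), Op (Qp U'), weak_solution nu alpha U' (Qy U') (Qp U')
        & forall y' p', Oy y' -> Op p' -> weak_solution nu alpha U' y' p' ->
            ae_eq leb2 Omega y' (Qy U') /\ eq_mod_const Omega p' (Qp U')]].

Definition reduced_cost (eta : R) (yO : R * R -> 'rV[R]_2)
    (Qy : 'M[R]_(l, 2) -> R * R -> 'rV[R]_2) (U : 'M[R]_(l, 2)) : R :=
  cost eta yO (Qy U) U.

Definition Uad (a b : 'M[R]_(l, 2)) : set 'M[R]_(l, 2) :=
  [set V | forall t i, a t i <= V t i <= b t i].

Definition Psi (eta : R) (z : R * R -> 'rV[R]_2) (U : 'M[R]_(l, 2)) (t : 'I_l) :
    'rV[R]_2 :=
  z (D t) + eta *: row t U.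

Definition sign_cond (a b U V : 'M[R]_(l, 2)) : Prop :=
  forall t i, (U t i = a t i -> 0 <= V t i) /\ (U t i = b t i -> V t i <= 0).

Definition cone (eta : R) (z : R * R -> 'rV[R]_2) (a b U : 'M[R]_(l, 2)) :
    set 'M[R]_(l, 2) :=
  [set V | sign_cond a b U V /\
           forall t i, Psi eta z U t 0 i <> 0 -> V t i = 0].

Definition cone_tau (tau eta : R) (z : R * R -> 'rV[R]_2)
    (a b U : 'M[R]_(l, 2)) : set 'M[R]_(l, 2) :=
  [set V | sign_cond a b U V /\
           forall t i, tau < `|Psi eta z U t 0 i| -> V t i = 0].

End ControlProblem.

(* Main.v *)
Require Import Defs.
From HB Require Import structures.
From mathcomp Require Import ring lra measurable_realfun separable.

Set Implicit Arguments.
Unset Strict Implicit.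
Unset Printing Implicit Defensive.

(** The sets [cone_tau] decrease to [cone] as tau goes to 0, and there are
    finitely many numbers Psi_t,i, so they coincide for tau small.  On this
    closed cone a continuous quadratic form is positive away from 0 iff it is
    coercive, by compactness of the unit sphere.

    What has to be shown is that V |-> j''(U)V^2 is a continuous quadratic form,
    i.e. that j is twice differentiable with the expected bilinear second
    derivative.  The state depends on the control in a C^2 way for the norm of
    H^1_0(rho), whereas the cost involves the unweighted L^2 norm, so one needs
    the embedding of H^1_0(rho) into L^2.  For a test function phi it follows
    from integrating the x_1-derivative of P(x_1) P'(x_1) phi^2, where P is the
    polynomial whose simple roots are the first coordinates of the points of D:
    P and P' being coprime, this bounds the integral of phi^2 by that of
    P^2 (phi^2 + |d_1 phi|^2), and P(x_1)^2 <= k rho(x) on the bounded set Omega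
    because alpha < 2.  Passing to limits of test functions requires weak
    derivatives to be unique almost everywhere (du Bois-Reymond), which is proved
    with products of exp(-1/s)-type functions increasing to indicators of boxes. *)

(** * Boxes, measurability and integration by parts in the plane *)

Section Boxes.
Context {R : realType}.
Local Notation T2 := (measurableTypeR R * measurableTypeR R)%type.

(** A Hardy inequality centred at each point of D would call for cut-offs. A polynomial P in the
    first coordinate alone vanishes on vertical lines through the points, so one integration by
    parts along horizontal lines serves all of them at once. A Bezout relation u P + v P' = 1 says
    that P and P' are never small together: where P is small, P'^2 phi^2 dominates, and this term
    occurs in the derivative of P P' phi^2, whose integral is 0. Convergence in the weighted norm
    says little about the unweighted one where [rho] is small. The limit is therefore taken on the
    sets where [rho] is at least 1/(n+1), with a final bound independent of n, before n grows. Two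
    encodings shape the rest. The representative [wpartial] is chosen arbitrarily, so it is linear
    only almost everywhere. The spaces are sets of functions whose norms vanish on null functions,
    so the calculus is done with explicit epsilon estimates for a possibly degenerate inner product
    on a subset of a module. *)

Definition obox (a b c d : R) : set (R * R) := `]a, b[ `*` `]c, d[.
Definition cbox (a b c d : R) : set (R * R) := `[a, b] `*` `[c, d].

Lemma measurable_obox a b c d : measurable (obox a b c d : set T2).
Proof. by apply: measurableX; exact: measurable_itv. Qed.

Lemma measurable_cbox a b c d : measurable (cbox a b c d : set T2).
Proof. by apply: measurableX; exact: measurable_itv. Qed.

Lemma compact_cbox a b c d : compact (cbox a b c d).
Proof. by apply: compact_setX; exact: segment_compact. Qed.

Lemma subset_obox_cbox a b c d : obox a b c d `<=` cbox a b c d.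
Proof. by move=> x [/= x1 x2]; split => /=; exact: subset_itv_oo_cc. Qed.

Lemma leb2_cbox_lty a b c d : (leb2 (cbox a b c d) < +oo)%E.
Proof.
have -> : leb2 (cbox a b c d) =
    (lebesgue_measure `[a, b] * lebesgue_measure `[c, d])%E.
  by apply: product_measure1E; exact: measurable_itv.
rewrite /= !lebesgue_measure_itv /=.
by do 2!case: ifPn => _; rewrite ?mul0e ?mule0 ?ltry// -!EFinB -EFinM ltry.
Qed.

(** Rational corners make the family of boxes countable. This yields the measurability of open sets
    for the product sigma-algebra, which is generated by rectangles, and lets almost everywhere
    statements on boxes be glued in [ae_eq_oboxes]. *)
Lemma open_cbox_rat (U : set (R * R)) x : open U -> U x ->
  exists q : rat * rat * (rat * rat),
    obox (ratr q.1.1) (ratr q.1.2) (ratr q.2.1) (ratr q.2.2) x /\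
    cbox (ratr q.1.1) (ratr q.1.2) (ratr q.2.1) (ratr q.2.2) `<=` U.
Proof.
move=> oU Ux; have /nbhs_ballP[e /= e0 xeU] : nbhs x U by exact: open_nbhs_nbhs.
have rb (u : R) : exists q : rat * rat,
    ratr q.1 < u < ratr q.2 /\ forall v, ratr q.1 <= v <= ratr q.2 -> `|u - v| < e.
  have [|p] := @rat_in_itvoo R (u - e / 2) u; first by rewrite ltrBlDr ltrDl divr_gt0.
  rewrite in_itv/= => /andP[p1 p2].
  have [|q] := @rat_in_itvoo R u (u + e / 2); first by rewrite ltrDl divr_gt0.
  rewrite in_itv/= => /andP[q1 q2].
  exists (p, q) => /=; split; first by rewrite p2.
  move=> v /andP[v1 v2]; rewrite ltr_norml; apply/andP; split; lra.
have [q1 [/andP[h1 h2] h3]] := rb x.1; have [q2 [/andP[k1 k2] k3]] := rb x.2.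
exists (q1, q2); split => /=.
  by split => /=; rewrite in_itv/=; apply/andP.
move=> y [/= ]; rewrite !in_itv/= => y1 y2; apply: xeU; split => /=; rewrite /ball/=.
- exact: h3.
- exact: k3.
Qed.

Lemma open_bigcup_obox (U : set (R * R)) : open U ->
  U = \bigcup_(q in [set q : rat * rat * (rat * rat) |
        cbox (ratr q.1.1) (ratr q.1.2) (ratr q.2.1) (ratr q.2.2) `<=` U])
      obox (ratr q.1.1) (ratr q.1.2) (ratr q.2.1) (ratr q.2.2).
Proof.
move=> oU; apply/seteqP; split => [x Ux|x [q /= qU /subset_obox_cbox /qU//]].
by have [q [qx qU]] := open_cbox_rat oU Ux; exists q.
Qed.

Lemma open_measurable2 (U : set (R * R)) : open U -> measurable (U : set T2).
Proof.
move=> oU; rewrite (open_bigcup_obox oU) bigcup_mkcond.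
apply: countable_bigcupT_measurable => // q.
by case: ifPn => // _; exact: measurable_obox.
Qed.

Lemma continuous_measurable2 (f : R * R -> R) : continuous f ->
  measurable_fun (setT : set T2) (f : T2 -> R).
Proof.
move=> /continuousP cf; apply: (measurability _ (RGenOpens.measurableE R)) => //.
move=> _ [_ [a [b ->] <-]]; rewrite setTI; apply: open_measurable2.
by apply: cf; exact: interval_open.
Qed.

Lemma bounded_sub_cbox (A : set (R * R)) : bounded_set A ->
  exists2 M, 0 < M & A `<=` cbox (- M) M (- M) M.
Proof.
move=> [M0 [_ M0K]].
have M1 : M0 < `|M0| + 1 by rewrite (le_lt_trans (ler_norm _))// ltrDl.
exists (`|M0| + 1); first by rewrite ltr_pwDr.
move=> x /(M0K _ M1) /=; rewrite prod_normE ge_max => /andP[x1 x2].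
by split => /=; rewrite in_itv/= -ler_norml.
Qed.

Lemma compact_sub_cbox (K : set (R * R)) : compact K ->
  exists2 M, 0 < M & K `<=` cbox (- M) M (- M) M.
Proof. by move=> /compact_bounded; exact: bounded_sub_cbox. Qed.

Lemma compact_measurable2 (K : set (R * R)) : compact K -> measurable (K : set T2).
Proof.
move=> cK; rewrite -[K]setCK; apply: measurableC; apply: open_measurable2.
by apply: closed_openC; apply: compact_closed => //; exact: norm_hausdorff.
Qed.

Lemma compact_leb2_lty (K : set (R * R)) : compact K -> (leb2 K < +oo)%E.
Proof.
move=> cK; have [M M0 KM] := compact_sub_cbox cK.
apply: le_lt_trans (leb2_cbox_lty (- M) M (- M) M); apply: le_measure => //.
- by rewrite inE; exact: compact_measurable2.
- by rewrite inE; exact: measurable_cbox.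
Qed.


Lemma continuous_integrable2 (f : R * R -> R) (K : set (R * R)) :
  continuous f -> compact K -> leb2.-integrable (K : set T2) (EFin \o f).
Proof.
move=> cf cK; apply: measurable_bounded_integrable.
- exact: compact_measurable2.
- exact: compact_leb2_lty.
- exact: measurable_funTS (continuous_measurable2 cf).
- have : compact (f @` K).
    by apply: continuous_compact => //; exact: continuous_subspaceT.
  move=> /compact_bounded [M [Mr MK]]; exists M; split => // x Mx y Ky.
  by apply: (MK _ Mx); exists y.
Qed.

Lemma integrable_support (D A : set T2) (f : R * R -> R) :
  measurable D -> measurable A -> A `<=` D ->
  (forall x, D x -> ~ A x -> f x = 0) ->
  leb2.-integrable A (EFin \o f) -> leb2.-integrable D (EFin \o f).
Proof.
move=> mD mA AD f0 /(integrable_mkcond _ mA) iA; apply/(integrable_mkcond _ mD).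
rewrite (_ : (EFin \o f) \_ D = (EFin \o f) \_ A)//; apply/funext => x.
rewrite !patchE; case: ifPn; case: ifPn => //.
- by rewrite notin_setE inE /= => Ax Dx; rewrite f0.
- by rewrite notin_setE inE => /AD.
Qed.

Lemma Rintegral_support (D A : set T2) (f : R * R -> R) :
  A `<=` D -> (forall x, D x -> ~ A x -> f x = 0) ->
  \int[leb2]_(x in D) f x = \int[leb2]_(x in A) f x.
Proof.
move=> AD f0; rewrite Rintegral_mkcond [RHS]Rintegral_mkcond.
congr (Rintegral _ _ _); apply/funext => x.
rewrite !patchE; case: ifPn; case: ifPn => //.
- by rewrite notin_setE inE => Ax Dx; rewrite f0.
- by rewrite notin_setE inE => /AD.
Qed.

Lemma integral_derive1_eq0 (f : R -> R) (M : R) : 0 < M ->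
  (forall s, derivable f s 1) -> continuous (derive1 f) ->
  (forall s, M <= `|s| -> f s = 0 /\ derive1 f s = 0) ->
  (\int[lebesgue_measure]_s (derive1 f s)%:E = 0)%E.
Proof.
move=> M0 df cf f0.
have MM : - M < M by lra.
have -> : (\int[lebesgue_measure]_s (derive1 f s)%:E =
    \int[lebesgue_measure]_(s in `[(- M)%R, M]) (derive1 f s)%:E)%E.
  rewrite [RHS]integral_mkcond; apply: eq_integral => x _; rewrite patchE.
  case: ifPn => //; rewrite notin_setE/= in_itv/= -ler_norml => /negP.
  by rewrite -ltNge => /ltW /f0[_ ->].
have cF : continuous f.
  by move=> x; apply: differentiable_continuous; apply/derivable1_diffP.
have cf' : {within `[(- M), M], continuous (derive1 f)}.
  exact: continuous_subspaceT.
have dF : derivable_oo_LRcontinuous f (- M) M.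
  split => [x _| |]; [exact: df| |].
  - by apply: cvg_at_right_filter; exact: cF.
  - by apply: cvg_at_left_filter; exact: cF.
have fM : f M = 0 by have [] := f0 M (ler_norm M).
have fNM : f (- M) = 0.
  by have [] := f0 (- M); rewrite ?normrN; first exact: ler_norm.
by rewrite (continuous_FTC2 MM cf' dF (fun _ _ => erefl)) fM fNM sube0.
Qed.

Lemma continuous_pairl (t : R) : continuous (fun u : R => (u, t)).
Proof. by move=> s; exact: differentiable_continuous. Qed.

Lemma continuous_pairr (s : R) : continuous (fun u : R => (s, u)).
Proof. by move=> t; exact: differentiable_continuous. Qed.

Lemma partial0E (f : R * R -> R) (s t : R) :
  partial 0 f (s, t) = derive1 (fun u => f (u, t)) s.
Proof.
have E : (fun h : R => h^-1 *: ((f \o shift (s, t)) (h *: (1, 0)) - f (s, t))) =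
    (fun h => h^-1 *: (((fun u => f (u, t)) \o shift s) (h *: 1) - f (s, t))).
  apply/funext => h /=; congr (_ *: (f _ - _)); rewrite /shift /=.
  by congr pair; rewrite /= ?scaler0 ?add0r.
by rewrite /partial /std_basis eqxx derive1E /derive E.
Qed.

Lemma partial1E (f : R * R -> R) (s t : R) :
  partial 1 f (s, t) = derive1 (fun u => f (s, u)) t.
Proof.
have E : (fun h : R => h^-1 *: ((f \o shift (s, t)) (h *: (0, 1)) - f (s, t))) =
    (fun h => h^-1 *: (((fun u => f (s, u)) \o shift t) (h *: 1) - f (s, t))).
  apply/funext => h /=; congr (_ *: (f _ - _)); rewrite /shift /=.
  by congr pair; rewrite /= ?scaler0 ?add0r.
by rewrite /partial /std_basis /= derive1E /derive E.
Qed.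

Lemma differentiable_section1 (f : R * R -> R) (s t : R) :
  differentiable f (s, t) -> derivable (fun u => f (u, t)) s 1.
Proof.
move=> df; apply/derivable1_diffP.
by apply: (@differentiable_comp _ _ _ _ (fun u => (u, t)) f).
Qed.

Lemma differentiable_section2 (f : R * R -> R) (s t : R) :
  differentiable f (s, t) -> derivable (fun u => f (s, u)) t 1.
Proof.
move=> df; apply/derivable1_diffP.
by apply: (@differentiable_comp _ _ _ _ (fun u => (s, u)) f).
Qed.

Lemma partial_eq0 j (F : R * R -> R) x : (\forall y \near x, F y = 0) ->
  partial j F x = 0.
Proof.
by move=> F0; rewrite /partial (@near_eq_derive _ _ _ F (cst 0) x _ F0) derive_cst.
Qed.

(** Fubini with the differentiated variable innermost: each section is a compactly supported C^1
    function of one variable, and its derivative integrates to 0. *)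
Lemma integral_partial_eq0 j (F : R * R -> R) (M : R) :
  (forall x, differentiable F x) -> continuous (partial j F) ->
  (forall x, ~ cbox (- M) M (- M) M x -> F x = 0) ->
  \int[leb2]_x (partial j F x) = 0.
Proof.
move=> dF cF F0.
have dF0 x : ~ cbox (- M) M (- M) M x -> partial j F x = 0.
  move=> Kx; apply: partial_eq0; near=> y; apply: F0; near: y.
  apply: open_nbhs_nbhs; split => //; apply: closed_openC; apply: compact_closed.
  - exact: norm_hausdorff.
  - exact: compact_cbox.
have iF : leb2.-integrable setT (EFin \o partial j F).
  apply: (@integrable_support _ (cbox (- M) M (- M) M)) => //.
  - exact: measurable_cbox.
  - by move=> x _; exact: dF0.
  - by apply: continuous_integrable2 => //; exact: compact_cbox.
(* [M] may be negative. The margin 1 makes [L] positive and puts every point having a coordinate of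
   modulus at least [L] outside the closed box. *)
pose L := `|M| + 1; have L0 : 0 < L by rewrite /L ltr_pwDr.
have out s t : (L <= `|s|) || (L <= `|t|) -> F (s, t) = 0 /\ partial j F (s, t) = 0.
  move=> h; have nK : ~ cbox (- M) M (- M) M (s, t).
    move=> [/=]; rewrite !in_itv/= -!ler_norml => sM tM.
    by move: h; rewrite /L; case/orP; have := ler_norm M; lra.
  by split; [exact: F0|exact: dF0].
rewrite /Rintegral; case: (j =P 0) => [j0|/eqP j0].
  rewrite -(@integral21_prod_meas1 _ _ _ _ _ lebesgue_measure lebesgue_measure _ iF).
  rewrite /fubini_G /= (@eq_integral _ _ _ _ _ (cst 0%E)) ?integral0//.
  move=> t _ /=.
  suff : (\int[lebesgue_measure]_s (derive1 (fun u : R => F (u, t)) s)%:E = 0)%E.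
    by move=> <-; apply: eq_integral => s _; rewrite j0 partial0E.
  apply: (integral_derive1_eq0 L0).
  - by move=> s; exact: differentiable_section1.
  - move=> s; rewrite (_ : derive1 _ = (partial j F) \o (fun u => (u, t))); last first.
      by apply/funext => u /=; rewrite j0 partial0E.
    apply: continuous_comp; last exact: cF.
    exact: continuous_pairl.
  - by move=> s Ls; rewrite -partial0E -j0; apply: out; rewrite Ls.
have {}j0 : j = 1 by case: j {cF dF0 iF out} j0 => [[|[|//]]] // i _; exact/val_inj.
rewrite -(@integral12_prod_meas1 _ _ _ _ _ lebesgue_measure lebesgue_measure _ iF).
rewrite /fubini_F /= (@eq_integral _ _ _ _ _ (cst 0%E)) ?integral0//.
move=> s _ /=.
suff : (\int[lebesgue_measure]_t (derive1 (fun u : R => F (s, u)) t)%:E = 0)%E.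
  by move=> <-; apply: eq_integral => t _; rewrite j0 partial1E.
apply: (integral_derive1_eq0 L0).
- by move=> t; exact: differentiable_section2.
- move=> t; rewrite (_ : derive1 _ = (partial j F) \o (fun u => (s, u))); last first.
    by apply/funext => u /=; rewrite j0 partial1E.
  apply: continuous_comp; last exact: cF.
  exact: continuous_pairr.
- by move=> t Lt; rewrite -partial1E -j0; apply: out; rewrite Lt orbT.
Unshelve. all: by end_near. Qed.

End Boxes.

(** * Smooth functions and test functions *)

Section Smooth.
Context {R : realType}.
Local Notation T2 := (measurableTypeR R * measurableTypeR R)%type.
Implicit Types (f g phi : R * R -> R) (p : {poly R}).

Lemma partialD j f g x : differentiable f x -> differentiable g x ->
  partial j (f + g) x = partial j f x + partial j g x.
Proof. by move=> df dg; rewrite /partial deriveD//; exact: diff_derivable. Qed.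

Lemma partialM j f g x : differentiable f x -> differentiable g x ->
  partial j (f * g) x = f x * partial j g x + g x * partial j f x.
Proof. by move=> df dg; rewrite /partial deriveM//; exact: diff_derivable. Qed.

Lemma Ck_continuous k f : Ck k f -> continuous f.
Proof. by case: k => [//|k] [df _] x; exact/differentiable_continuous. Qed.

Lemma CkS k f : Ck k.+1 f -> Ck k f.
Proof.
elim: k f => [|k IH] f; first exact: Ck_continuous.
by move=> [df pf]; split => // j; apply: IH; exact: pf.
Qed.

Lemma Ck_cst k (c : R) : Ck k (cst c).
Proof.
elim: k c => [|k IH] c /=; first exact: cst_continuous.
split => [x|j]; first exact: differentiable_cst.
rewrite (_ : partial j (cst c) = cst 0); first exact: IH.
by apply/funext => x; rewrite /partial derive_cst.
Qed.

Lemma CkD k f g : Ck k f -> Ck k g -> Ck k (f + g).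
Proof.
elim: k f g => [|k IH] f g /=.
  by move=> cf cg x; apply: continuousD; [exact: cf|exact: cg].
move=> [df pf] [dg pg]; split => [x|j]; first exact: differentiableD.
rewrite (_ : partial j (f + g) = partial j f + partial j g); first exact: IH.
by apply/funext => x; rewrite partialD.
Qed.

Lemma CkM k f g : Ck k f -> Ck k g -> Ck k (f * g).
Proof.
elim: k f g => [|k IH] f g.
  by move=> /= cf cg x; apply: continuousM; [exact: cf|exact: cg].
move=> cf cg; have [df pf] := cf; have [dg pg] := cg.
split => [x|j]; first exact: differentiableM.
rewrite (_ : partial j (f * g) = f * partial j g + g * partial j f).
  by apply: CkD; apply: IH; [exact: CkS|exact: (pg j)|exact: CkS|exact: (pf j)].
by apply/funext => x; rewrite partialM.
Qed.

Lemma CkZ k (c : R) f : Ck k f -> Ck k (c *: f).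
Proof.
by move=> cf; rewrite (_ : c *: f = cst c * f)//; apply: CkM => //; exact: Ck_cst.
Qed.

Lemma differentiable_fst2 x : differentiable (fun y : R * R => y.1) x.
Proof.
have h := @linear_differentiable R (R * R)%type R fst x.
by apply: h => y; exact: cvg_fst.
Qed.

Lemma differentiable_snd2 x : differentiable (fun y : R * R => y.2) x.
Proof.
have h := @linear_differentiable R (R * R)%type R snd x.
by apply: h => y; exact: cvg_snd.
Qed.

Lemma differentiable_coord1 (c d : R) x :
  differentiable (fun y : R * R => c * y.1 + d) x.
Proof.
apply: differentiableD; last exact: differentiable_cst.
by apply: differentiableM; [exact: differentiable_cst|exact: differentiable_fst2].
Qed.

Lemma differentiable_coord2 (c d : R) x :
  differentiable (fun y : R * R => c * y.2 + d) x.
Proof.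
apply: differentiableD; last exact: differentiable_cst.
by apply: differentiableM; [exact: differentiable_cst|exact: differentiable_snd2].
Qed.

Lemma derive1_affine (c d s : R) : derive1 (fun u : R => c * u + d) s = c.
Proof.
rewrite derive1E deriveD; last exact: derivable_cst.
  by rewrite derive_cst addr0 deriveMl ?derive_id ?mulr1//; exact: derivable_id.
by apply: derivableM; [exact: derivable_cst|exact: derivable_id].
Qed.

Lemma derivable_affine (c d s : R) : derivable (fun u : R => c * u + d) s 1.
Proof.
apply: derivableD; last exact: derivable_cst.
by apply: derivableM; [exact: derivable_cst|exact: derivable_id].
Qed.

Lemma differentiable_comp1 (h : R -> R) (c d : R) x :
  derivable h (c * x.1 + d) 1 -> differentiable (fun y : R * R => h (c * y.1 + d)) x.
Proof.
move=> /derivable1_diffP dh.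
by apply: (@differentiable_comp _ _ _ _ (fun y : R * R => c * y.1 + d) h) => //;
  exact: differentiable_coord1.
Qed.

Lemma differentiable_comp2 (h : R -> R) (c d : R) x :
  derivable h (c * x.2 + d) 1 -> differentiable (fun y : R * R => h (c * y.2 + d)) x.
Proof.
move=> /derivable1_diffP dh.
by apply: (@differentiable_comp _ _ _ _ (fun y : R * R => c * y.2 + d) h) => //;
  exact: differentiable_coord2.
Qed.

Lemma partial_comp1 (h : R -> R) (c d : R) j x :
  derivable h (c * x.1 + d) 1 -> partial j (fun y : R * R => h (c * y.1 + d)) x =
  if j == 0 then derive1 h (c * x.1 + d) * c else 0.
Proof.
case: x => s t /= dh; case: ifPn => [/eqP ->|j0].
  by rewrite partial0E (derive1_comp (@derivable_affine c d s) dh) derive1_affine.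
have -> : j = 1 by case: j j0 => [[|[|//]]] // i _; exact/val_inj.
by rewrite partial1E /= derive1_cst.
Qed.

Lemma partial_comp2 (h : R -> R) (c d : R) j x :
  derivable h (c * x.2 + d) 1 -> partial j (fun y : R * R => h (c * y.2 + d)) x =
  if j == 0 then 0 else derive1 h (c * x.2 + d) * c.
Proof.
case: x => s t /= dh; case: ifPn => [/eqP ->|j0].
  by rewrite partial0E /= derive1_cst.
have -> : j = 1 by case: j j0 => [[|[|//]]] // i _; exact/val_inj.
by rewrite partial1E (derive1_comp (@derivable_affine c d t) dh) derive1_affine.
Qed.

Lemma scaleRE (a b : R) : a *: b = a * b :> R.
Proof. by []. Qed.

(* The class of the functions [flat p] is stable under differentiation. *)
Definition flat p (s : R) : R := if 0 < s then p.[s^-1] * expR (- s^-1) else 0.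

(** The exponential series gives s^(-i) exp(-1/s) <= (i+1)! s for s > 0: taking the term one degree
    above the monomial leaves a factor s. *)
Lemma flat_le p : exists2 C, 0 <= C & forall s, `|flat p s| <= C * `|s|.
Proof.
exists (\sum_(i < size p) `|p`_i| * (i.+1)`!%:R).
  by apply: sumr_ge0 => i _; rewrite mulr_ge0.
move=> s; rewrite /flat; case: ifPn => [s0|_]; last first.
  by rewrite normr0 mulr_ge0// sumr_ge0// => i _; rewrite mulr_ge0.
rewrite horner_coef mulr_suml mulr_suml (le_trans (ler_norm_sum _ _ _))//.
apply: ler_sum => i _; rewrite !normrM -!mulrA ler_wpM2l//.
rewrite (gtr0_norm s0) (gtr0_norm (expR_gt0 _)) ger0_norm; last first.
  by rewrite exprn_ge0// invr_ge0 ltW.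
have si : 0 <= s^-1 by rewrite invr_ge0 ltW.
have := expR_ge1Dxn i si; set E := expR _ => hE.
rewrite expRN -/E; have E0 : 0 < E by exact: expR_gt0.
rewrite ler_pdivrMr//.
have h : s^-1 ^+ i.+1 <= E * (i.+1)`!%:R.
  by rewrite -ler_pdivrMr ?ltr0n ?fact_gt0//; apply: le_trans hE; rewrite lerDr.
have -> : s^-1 ^+ i = s * s^-1 ^+ i.+1 by rewrite exprS mulrA mulfV ?mul1r// gt_eqF.
rewrite (le_trans (ler_wpM2l (ltW s0) h))//.
by rewrite le_eqVlt; apply/orP; left; apply/eqP; ring.
Qed.

Lemma flat0 p : flat p 0 = 0.
Proof. by rewrite /flat ltxx. Qed.

(** The difference quotient of [flat p] at 0 is thus [flat (p * 'X)], which tends to 0 by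
    [flat_le]. *)
Lemma flatX p s : flat p s = s * flat (p * 'X) s.
Proof.
rewrite /flat; case: ifPn => s0; last by rewrite mulr0.
by rewrite hornerMX; field; rewrite gt_eqF.
Qed.

(** The polynomial is read off for s > 0, where the derivative of p(1/s) exp(-1/s) is s^(-2) (p -
    p')(1/s) exp(-1/s). *)
Lemma is_derive_flat p (s : R) :
  is_derive s 1 (flat p) (flat ('X^2 * (p - p^`())) s).
Proof.
have [s0|s0|->] := ltgtP s 0.
- rewrite [X in is_derive _ _ _ X]/flat ltNge (ltW s0)/=.
  have hc : is_derive s 1 (cst 0 : R -> R) 0 by exact: is_derive_cst.
  apply: near_eq_is_derive hc; near=> t; rewrite /flat ltNge (_ : t <= 0)//; apply: ltW; near: t.
  exact: lt_nbhsl.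
- have sn0 : s != 0 by rewrite gt_eqF.
  rewrite [X in is_derive _ _ _ X]/flat s0.
  suff hd : is_derive s 1 (fun t : R => p.[t^-1] * expR (- t^-1))
      (('X^2 * (p - p^`())).[s^-1] * expR (- s^-1)).
    apply: near_eq_is_derive hd; near=> t.
    by rewrite /flat (_ : 0 < t)//; near: t; exact: lt_nbhsr.
  have dV : is_derive s 1 (fun t : R => t^-1) (- s ^- 2).
    have := @is_deriveV R id s 1 1 sn0 _; rewrite scaler1; apply.
  have d1 : is_derive s 1 (fun t : R => p.[t^-1]) (p^`().[s^-1] * (- s ^- 2)).
    have := @is_derive1_comp R (horner p) (fun t => t^-1) s _ _ _ dV.
    by move=> /(_ _ (is_derive_poly p _)); rewrite mulrC.
  have d2 : is_derive s 1 (fun t : R => expR (- t^-1)) (expR (- s^-1) * (s ^- 2)).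
    have dN : is_derive s 1 (fun t : R => - t^-1) (s ^- 2).
      by have := is_deriveN dV; rewrite opprK.
    have := @is_derive1_comp R expR (fun t => - t^-1) s _ _ _ dN.
    by move=> /(_ _ (is_derive_expR _)); rewrite mulrC.
  refine (is_derive_eq (is_deriveM d1 d2) _).
  rewrite !scaleRE hornerM hornerXn hornerD hornerN -exprVn; ring.
- rewrite flat0; have [C C0 pC] := flat_le (p * 'X).
  have h0 : h^-1 *: ((flat p \o shift 0) (h *: 1) - flat p 0) @[h --> 0^'] --> (0 : R).
    apply/cvgrPdist_le => e e0; near=> h.
    have hn0 : h != 0 by near: h; exact: nbhs_dnbhs_neq.
    rewrite sub0r normrN flat0 subr0 /= addr0 flatX.
    rewrite !scaleRE mulr1 mulrA mulVf// mul1r (le_trans (pC _))//.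
    have hC : `|h| <= e / (C + 1).
      near: h; apply: dnbhs0_le.
      by rewrite divr_gt0// ltr_wpDl.
    rewrite ler_pdivlMr ?ltr_wpDl// in hC; apply: le_trans hC.
    by rewrite mulrC ler_wpM2l// lerDl.
  by apply: DeriveDef; [apply/cvg_ex; exists 0|apply/cvg_lim].
Unshelve. all: by end_near. Qed.

Lemma derivable_flat p s : derivable (flat p) s 1.
Proof. by have [] := is_derive_flat p s. Qed.

Lemma derive1_flat p : derive1 (flat p) = flat ('X^2 * (p - p^`())).
Proof.
by apply/funext => s; rewrite derive1E; have [_ ->] := is_derive_flat p s.
Qed.

Lemma Ck_flat1 k p (c d : R) : Ck k (fun x => flat p (c * x.1 + d)).
Proof.
have df q x : differentiable (fun x : R * R => flat q (c * x.1 + d)) x.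
  exact/differentiable_comp1/derivable_flat.
elim: k p => [|k IH] p /=; first by move=> x; exact: differentiable_continuous.
split => [x|j]; first exact: df.
rewrite (_ : partial j _ = (if j == 0 then c else 0) *:
  (fun x => flat ('X^2 * (p - p^`())) (c * x.1 + d))); first by apply: CkZ.
apply/funext => x; rewrite partial_comp1; last exact: derivable_flat.
rewrite derive1_flat; case: ifPn => _; rewrite /GRing.scale /=.
  by rewrite mulrC.
by rewrite scale0r.
Qed.

Lemma Ck_flat2 k p (c d : R) : Ck k (fun x => flat p (c * x.2 + d)).
Proof.
have df q x : differentiable (fun x : R * R => flat q (c * x.2 + d)) x.
  exact/differentiable_comp2/derivable_flat.
elim: k p => [|k IH] p /=; first by move=> x; exact: differentiable_continuous.
split => [x|j]; first exact: df.
rewrite (_ : partial j _ = (if j == 0 then 0 else c) *: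
  (fun x => flat ('X^2 * (p - p^`())) (c * x.2 + d))); first by apply: CkZ.
apply/funext => x; rewrite partial_comp2; last exact: derivable_flat.
rewrite derive1_flat; case: ifPn => _; rewrite /GRing.scale /=.
  by rewrite scale0r.
by rewrite mulrC.
Qed.

(** For n > 0, a product of four factors exp(-1/s), with s equal to n times the signed distance to
    each side: positive exactly on the open box, and increasing with n to its indicator. The
    arguments are in the affine form that [Ck_flat1] and [Ck_flat2] expect. *)
Definition bump (a b c d : R) (n : R) : R * R -> R :=
  (fun x => flat 1 (n * x.1 + - (n * a))) * (fun x => flat 1 (- n * x.1 + n * b)) *
  ((fun x => flat 1 (n * x.2 + - (n * c))) * (fun x => flat 1 (- n * x.2 + n * d))).

Lemma bumpE a b c d n x : bump a b c d n x =
  flat 1 (n * (x.1 - a)) * flat 1 (n * (b - x.1)) *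
  (flat 1 (n * (x.2 - c)) * flat 1 (n * (d - x.2))).
Proof.
have -> : n * (x.1 - a) = n * x.1 + - (n * a) by ring.
have -> : n * (b - x.1) = - n * x.1 + n * b by ring.
have -> : n * (x.2 - c) = n * x.2 + - (n * c) by ring.
by have -> : n * (d - x.2) = - n * x.2 + n * d by ring.
Qed.

Lemma Ck_bump k a b c d n : Ck k (bump a b c d n).
Proof.
by apply: CkM; apply: CkM; [exact: Ck_flat1..|exact: Ck_flat2|exact: Ck_flat2].
Qed.

Lemma flat1_01 s : 0 <= flat 1 s <= 1.
Proof.
rewrite /flat; case: ifPn => s0; last by rewrite lexx ler01.
by rewrite hornerE mul1r expR_ge0/= -expR0 ler_expR oppr_le0 invr_ge0 ltW.
Qed.

Lemma bump_01 a b c d n x : 0 <= bump a b c d n x <= 1.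
Proof.
rewrite bumpE; have /andP[a0 a1] := flat1_01 (n * (x.1 - a)).
have /andP[b0 b1] := flat1_01 (n * (b - x.1)).
have /andP[c0 c1] := flat1_01 (n * (x.2 - c)).
have /andP[d0 d1] := flat1_01 (n * (d - x.2)).
by rewrite !mulr_ge0//= !mulr_ile1 // mulr_ge0.
Qed.

Lemma bump_out a b c d n x : 0 < n -> ~ obox a b c d x -> bump a b c d n x = 0.
Proof.
move=> n0 nx; rewrite bumpE; apply/eqP; apply: contra_notT nx.
rewrite !mulf_eq0 !negb_or => /andP[/andP[h1 h2] /andP[h3 h4]].
have pos s : flat 1 (n * s) != 0 -> 0 < s.
  by rewrite /flat; case: ifPn => //; rewrite ?eqxx// pmulr_rgt0.
move: h1 h2 h3 h4 => /pos h1 /pos h2 /pos h3 /pos h4.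
by split; rewrite /= in_itv/=; apply/andP; split; lra.
Qed.

Lemma cvg_bump a b c d x : obox a b c d x ->
  bump a b c d k.+1%:R x @[k --> \oo] --> (1 : R).
Proof.
have cv s : 0 < s -> flat 1 (k.+1%:R * s) @[k --> \oo] --> (1 : R).
  move=> s0; rewrite (_ : (fun k : nat => _) =
      expR \o (fun k => - s^-1 * (k.+1%:R)^-1)); last first.
    apply/funext => k /=; rewrite /flat mulr_gt0//.
    by rewrite hornerE mul1r invfM mulNr mulrC.
  rewrite -[X in _ --> X]expR0; apply: continuous_cvg; first exact: continuous_expR.
  rewrite -[X in _ --> X](mulr0 (- s^-1)).
  by apply: cvgMr; exact: cvg_harmonic.
move=> [/=]; rewrite !in_itv/= => /andP[h1 h2] /andP[h3 h4].
rewrite (_ : (fun k : nat => _) = fun k =>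
  flat 1 (k.+1%:R * (x.1 - a)) * flat 1 (k.+1%:R * (b - x.1)) *
  (flat 1 (k.+1%:R * (x.2 - c)) * flat 1 (k.+1%:R * (d - x.2)))); last first.
  by apply/funext => k; rewrite bumpE.
have pos (u v : R) : u < v -> 0 < v - u by rewrite subr_gt0.
have := cvgM (cvgM (cv _ (pos _ _ h1)) (cv _ (pos _ _ h2)))
             (cvgM (cv _ (pos _ _ h3)) (cv _ (pos _ _ h4))).
by rewrite !mulr1; apply.
Qed.

(** * Stability properties of test functions *)

Section Test.
Variable Omega : set (R * R).

Lemma closed_cbox a b c d : closed (cbox a b c d : set (R * R)).
Proof. by apply: compact_closed; [exact: norm_hausdorff|exact: compact_cbox]. Qed.

Lemma test_bump a b c d n : 0 < n -> cbox a b c d `<=` Omega ->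
  test Omega (bump a b c d n).
Proof.
move=> n0 bO.
have sub : closure [set x | bump a b c d n x != 0] `<=` cbox a b c d.
  rewrite [X in _ `<=` X]((closure_id _).1 (@closed_cbox a b c d)).
  apply: closureS => x /= /eqP; apply: contra_notP => nx.
  by apply: bump_out => // /subset_obox_cbox.
split; [by move=> k; exact: Ck_bump| |exact: subset_trans sub bO].
by apply: subclosed_compact sub; [exact: closed_closure|exact: compact_cbox].
Qed.

Lemma testD f g : test Omega f -> test Omega g -> test Omega (f + g).
Proof.
move=> [cf kf sf] [cg kg sg].
have sub : closure [set x | (f + g) x != 0] `<=`
    closure [set x | f x != 0] `|` closure [set x | g x != 0].
  rewrite -closureU; apply: closureS => x /=; case: (eqVneq (f x) 0) => [fx|fx _].
    have -> : (f + g) x = f x + g x by [].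
    by rewrite fx add0r; right.
  by left.
split; first by move=> k; exact: CkD.
- by apply: subclosed_compact sub; [exact: closed_closure|exact: compactU].
- by apply: subset_trans sub _ => x [/sf|/sg].
Qed.

Lemma testZ (c : R) f : test Omega f -> test Omega (c *: f).
Proof.
move=> [cf kf sf].
have sub : closure [set x | (c *: f) x != 0] `<=` closure [set x | f x != 0].
  apply: closureS => x /=; apply: contra_neq => fx.
  by have -> : (c *: f) x = c * f x by []; rewrite fx mulr0.
split; first by move=> k; exact: CkZ.
- by apply: subclosed_compact sub => //; exact: closed_closure.
- exact: subset_trans sub sf.
Qed.

Lemma test_partial j f : test Omega f -> test Omega (partial j f).
Proof.
move=> [cf kf sf].
have sub : closure [set x | partial j f x != 0] `<=` closure [set x | f x != 0].
  rewrite [X in _ `<=` X]((closure_id _).1 (@closed_closure _ [set x | f x != 0])).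
  apply: closureS => x /= /eqP; apply: contra_notP => nx; apply: partial_eq0.
  have : open (~` closure [set x | f x != 0]) by exact/closed_openC/closed_closure.
  rewrite openE => /(_ x nx); apply: filterS => y ny; apply/eqP.
  by apply: contra_notT ny => fy; exact: subset_closure.
split; first by move=> k; have [_] := cf k.+1; exact.
- by apply: subclosed_compact sub => //; exact: closed_closure.
- exact: subset_trans sub sf.
Qed.

End Test.

End Smooth.

(** * The du Bois-Reymond lemma *)

Section DuBoisReymond.
Context {R : realType}.
Local Notation T2 := (measurableTypeR R * measurableTypeR R)%type.
Implicit Types (f g h phi : R * R -> R).

Definition oboxes : set (set T2) :=
  [set A | exists a b c d : R, A = obox a b c d].

Lemma oboxI (a b c d a' b' c' d' : R) : obox a b c d `&` obox a' b' c' d' =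
  obox (Num.max a a') (Num.min b b') (Num.max c c') (Num.min d d').
Proof.
apply/seteqP; split => x.
  move=> [[/= ]]; rewrite !in_itv/= => /andP[a1 a2] /andP[a3 a4] [/=].
  rewrite !in_itv/= => /andP[b1 b2] /andP[b3 b4].
  by split; rewrite /= in_itv/= gt_max lt_min; apply/andP; split; apply/andP.
move=> [/= ]; rewrite !in_itv/= !gt_max !lt_min.
move=> /andP[/andP[a1 a2] /andP[a3 a4]] /andP[/andP[b1 b2] /andP[b3 b4]].
by split; split; rewrite /= in_itv/=; apply/andP.
Qed.

Lemma setI_closed_oboxes : setI_closed oboxes.
Proof.
move=> A B [a [b [c [d ->]]]] [a' [b' [c' [d' ->]]]]; rewrite oboxI.
by exists (Num.max a a'), (Num.min b b'), (Num.max c c'), (Num.min d d').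
Qed.

Lemma itv_bnd_nat (x : R) : exists n : nat, x \in `](- n%:R), n%:R[.
Proof.
exists (Num.bound `|x|); rewrite in_itv/= -ltr_norml.
by rewrite archi_boundP.
Qed.

(** It is enough that both coordinate maps are measurable for the sigma-algebra generated by the
    boxes. The preimage of an open interval is a strip, which is a countable union of boxes of
    growing length. *)
Lemma measurable_oboxes (A : set T2) : measurable A -> <<s oboxes >> A.
Proof.
pose T3 := g_sigma_algebraType oboxes.
have m1 : measurable_fun (setT : set T3) (fun x : T3 => x.1 : R).
  apply: (measurability _ (RGenOpens.measurableE R)) => //.
  move=> _ [_ [a [b ->] <-]]; rewrite setTI.
  rewrite (_ : _ @^-1` _ = \bigcup_(n : nat) (obox a b (- n%:R) n%:R)).
    by apply: bigcupT_measurable => n; apply: sub_sigma_algebra; do 4!eexists.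
  apply/seteqP; split => [x /= x1|x [n _ []//]].
  by have [n nx] := itv_bnd_nat x.2; exists n.
have m2 : measurable_fun (setT : set T3) (fun x : T3 => x.2 : R).
  apply: (measurability _ (RGenOpens.measurableE R)) => //.
  move=> _ [_ [a [b ->] <-]]; rewrite setTI.
  rewrite (_ : _ @^-1` _ = \bigcup_(n : nat) (obox (- n%:R) n%:R a b)).
    by apply: bigcupT_measurable => n; apply: sub_sigma_algebra; do 4!eexists.
  apply/seteqP; split => [x /= x1|x [n _ []//]].
  by have [n nx] := itv_bnd_nat x.1; exists n.
move: A; apply: smallest_sub; first exact: smallest_sigma_algebra.
move=> A [|] [B mB <-].
- by apply: m1.
- by apply: m2.
Qed.

Variable Omega : set (R * R).
Hypothesis Omega_open : open Omega.
Let mOmega : measurable (Omega : set T2) := open_measurable2 Omega_open.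

(** The measurable sets on whose trace on the box [h] has integral 0 form a Dynkin system containing
    all open boxes, which are stable under intersection. By the pi-lambda theorem every measurable
    set is reached. Traces are used because [h] is integrable only on the box. *)
Lemma integral_oboxes_eq0 h (a b c d : R) :
  leb2.-integrable (obox a b c d : set T2) (EFin \o h) ->
  (forall a' b' c' d' : R, obox a' b' c' d' `<=` obox a b c d ->
    (\int[leb2]_(x in obox a' b' c' d') (h x)%:E = 0)%E) ->
  ae_eq leb2 (obox a b c d) h (cst 0).
Proof.
move=> ih h0; set Q := obox a b c d.
have mQ : measurable (Q : set T2) by exact: measurable_obox.
pose H (A : set T2) := measurable A /\ (\int[leb2]_(x in A `&` Q) (h x)%:E = 0)%E.
have iI A : measurable A -> leb2.-integrable (A `&` Q : set T2) (EFin \o h).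
  move=> mA; apply: integrableS ih => //; first exact: measurableI.
have dH : dynkin H.
  split.
  - by split => //; rewrite setTI; apply: h0.
  - move=> A [mA hA]; split; first exact: measurableC.
    have : (\int[leb2]_(x in Q) (h x)%:E = 0)%E by exact: h0.
    have QE : Q = (A `&` Q) `|` (~` A `&` Q) by rewrite -setIUl setUv setTI.
    rewrite {1}QE integral_setU_EFin //.
    + by rewrite hA add0e.
    + exact: measurableI.
    + by apply: measurableI => //; exact: measurableC.
    + by rewrite -QE; apply/measurable_EFinP; exact: measurable_int ih.
    + by apply/disj_setPS => x [[Ax _] [nAx _]].
  - move=> F tF HF; have mF i : measurable (F i) by have [] := HF i.
    split; first exact: bigcupT_measurable.
    rewrite setI_bigcupl integral_bigcup.
    + by rewrite eseries0// => i _ _; have [] := HF i.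
    + exact: trivIset_setIr.
    + by move=> k; exact: measurableI.
    + by rewrite -setI_bigcupl; apply: iI; exact: bigcupT_measurable.
have Hall (A : set T2) : measurable A -> H A.
  move=> /measurable_oboxes; rewrite -(setI_closed_g_dynkin_g_sigma_algebra setI_closed_oboxes).
  apply: smallest_sub => // B [a' [b' [c' [d' ->]]]]; split.
    exact: measurable_obox.
  rewrite /Q oboxI; apply: h0; rewrite -oboxI; exact: subIsetr.
have : ae_eq leb2 Q (EFin \o h) (cst 0%E).
  apply: integral_ae_eq => // E EQ mE.
  rewrite integral0; have [_] := Hall E mE.
  by rewrite (setIidl EQ).
by apply: filterS => x /= + Qx => /(_ Qx) [].
Qed.

Lemma ae_eq_oboxes h :
  (forall a b c d : R, cbox a b c d `<=` Omega ->
     ae_eq leb2 (obox a b c d) h (cst 0)) ->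
  ae_eq leb2 Omega h (cst 0).
Proof.
move=> H.
(* The rational boxes are numbered through [unpickle], so that countably many null sets can be
   joined by [ae_foralln]. *)
pose P (n : nat) (x : T2) := forall q : rat * rat * (rat * rat),
  unpickle n = Some q ->
  cbox (ratr q.1.1) (ratr q.1.2) (ratr q.2.1) (ratr q.2.2) `<=` Omega ->
  obox (ratr q.1.1) (ratr q.1.2) (ratr q.2.1) (ratr q.2.2) x -> h x = 0.
have : \forall x \ae leb2, forall n, P n x.
  apply: ae_foralln => n; rewrite /P.
  case: (unpickle n) => [q|]; last exact: aeW.
  have [qO|qO] := pselect (cbox (ratr q.1.1) (ratr q.1.2) (ratr q.2.1)
                                (ratr q.2.2) `<=` Omega).
    by apply: filterS (H _ _ _ _ qO) => x hx _ [<-] _ /hx.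
  by apply: aeW => x _ [<-] /qO.
apply: filterS => x Px Ox; have [q [qx qO]] := open_cbox_rat Omega_open Ox.
exact: (Px (pickle q) q (pickleK _)).
Qed.

Lemma loc_integrableM h phi (K : set (R * R)) :
  loc_integrable Omega h -> continuous phi -> compact K -> K `<=` Omega ->
  (forall x, ~ K x -> phi x = 0) ->
  leb2.-integrable (Omega : set T2) (EFin \o (fun x => h x * phi x)).
Proof.
move=> [mh ih] cphi cK KO phi0.
have mK := compact_measurable2 cK.
apply: (@integrable_support _ _ K) => //.
  by move=> x _ nK; rewrite phi0// mulr0.
have := @integrableMl _ _ _ leb2 K mK (EFin \o h) phi (ih _ KO cK).
have -> : ((EFin \o h) \* (EFin \o phi))%E = EFin \o (fun x => h x * phi x).
  by apply/funext => x /=; rewrite EFinM.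
apply.
  exact: measurable_funTS (continuous_measurable2 cphi).
have : compact (phi @` K).
  by apply: continuous_compact => //; exact: continuous_subspaceT.
move=> /compact_bounded [M [Mr MK]]; exists M; split => // x Mx y Ky.
by apply: (MK _ Mx); exists y.
Qed.

Lemma loc_integrable_test h phi : loc_integrable Omega h -> test Omega phi ->
  leb2.-integrable (Omega : set T2) (EFin \o (fun x => h x * phi x)).
Proof.
move=> lh [cphi kphi sphi]; apply: (loc_integrableM lh _ kphi sphi).
  exact: (cphi 0).
by move=> x nx; apply/eqP; apply: contra_notT nx => h0; exact: subset_closure.
Qed.

(** Testing against [bump] with growing parameter, dominated convergence shows that [h] has integral
    0 over every open box whose closed box lies in [Omega]. *)
Lemma du_bois_reymond h : loc_integrable Omega h ->
  (forall phi, test Omega phi -> \int[leb2]_(x in Omega) (h x * phi x) = 0) ->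
  ae_eq leb2 Omega h (cst 0).
Proof.
move=> lh h0; apply: ae_eq_oboxes => a b c d qO.
have mh := lh.1.
have ic (a' b' c' d' : R) : cbox a' b' c' d' `<=` Omega ->
    leb2.-integrable (cbox a' b' c' d' : set T2) (EFin \o h).
  by move=> cO; apply: lh.2 => //; exact: compact_cbox.
have key (a' b' c' d' : R) : cbox a' b' c' d' `<=` Omega ->
    (\int[leb2]_(x in obox a' b' c' d') (h x)%:E = 0)%E.
  move=> cO; set K := cbox a' b' c' d'; set Q := obox a' b' c' d'.
  have mK : measurable (K : set T2) by exact: measurable_cbox.
  have mQ : measurable (Q : set T2) by exact: measurable_obox.
  have mhK : measurable_fun (K : set T2) h by exact: measurable_funS mh.
  pose B n := bump a' b' c' d' n.+1%:R.
  pose F n x := (h x * B n x)%:E.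
  (* Pointwise limit of [F n] on all of [K]: the bumps tend to 1 on the open box and are 0 on its
     sides. *)
  pose G := (EFin \o h) \_ Q.
  have mF n : measurable_fun (K : set T2) (F n).
    apply/measurable_EFinP; apply: measurable_funM => //.
    by apply: measurable_funTS; apply: continuous_measurable2; exact: (Ck_bump 0).
  have QK : Q `<=` K := @subset_obox_cbox _ _ _ _ _.
  have mG : measurable_fun (K : set T2) G.
    apply/(measurable_restrict (EFin \o h) mQ mK).
    by apply: measurable_funS (measurable_int _ (ic _ _ _ _ cO)) => // x [].
  have iK := ic _ _ _ _ cO.
  have FG : {ae leb2, forall x, K x -> F ^~ x @ \oo --> G x}.
    apply: aeW => x Kx; rewrite /F /G patchE; case: ifPn => [|]; rewrite ?inE ?notin_setE => Qx.
      apply: cvg_EFin; first exact: nearW.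
      rewrite /comp /= -[X in _ --> X]mulr1; apply: cvgMr; exact: cvg_bump.
    rewrite (_ : (fun n => _) = cst 0%E); first exact: cvg_cst.
    by apply/funext => n; rewrite /B bump_out// mulr0.
  have dom : {ae leb2, forall x n, K x -> (`|F n x| <= `|(EFin \o h) x|)%E}.
    apply: aeW => x n _; rewrite /F /= lee_fin normrM ler_piMr//.
    by have /andP[B0 B1] := bump_01 a' b' c' d' n.+1%:R x; rewrite ger0_norm.
  have [iG _ cv] := @dominated_convergence _ _ _ leb2 K mK F G (abse \o (EFin \o h))
    mF mG FG (integrable_abse iK) dom.
  have F0 n : (\int[leb2]_(x in K) F n x = 0)%E.
    have tB : test Omega (B n) by exact: test_bump.
    have iF : leb2.-integrable (K : set T2) (F n).
      by apply: integrableS (loc_integrable_test lh tB).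
    have := h0 _ tB; rewrite (@Rintegral_support _ Omega K)//.
      by move=> E; rewrite -[LHS]fineK ?[fine _]E//; exact: integrable_fin_num.
    by move=> x _ nK; rewrite /B bump_out ?mulr0// => /subset_obox_cbox.
  have : (\int[leb2]_(x in K) G x = 0)%E.
    have c0 : (fun n => \int[leb2]_(x in K) F n x)%E @ \oo --> 0%E.
      by rewrite (_ : (fun n => _) = cst 0%E) ?(funext F0)//; exact: cvg_cst.
    exact: (cvg_unique _ cv c0).
  by rewrite /G -integral_mkcondr (setIidr QK).
apply: integral_oboxes_eq0.
  by apply: integrableS (ic _ _ _ _ qO) => //;
    [exact: measurable_cbox|exact: measurable_obox|exact: subset_obox_cbox].
move=> a' b' c' d' sub.
(* An empty open box may have corners anywhere, and then its closed box need not lie in [Omega].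
   Intersecting with the outer box clamps the corners. *)
rewrite -(setIidl sub) oboxI; apply: key; apply: subset_trans qO => x [/=].
rewrite !in_itv/= !ge_max !le_min => /andP[/andP[_ h1] /andP[_ h2]].
by move=> /andP[/andP[_ h3] /andP[_ h4]]; split; rewrite /= in_itv/=; apply/andP.
Qed.

End DuBoisReymond.

(** * Weak partial derivatives and weighted spaces *)

Section WeakPartial.
Context {R : realType}.
Local Notation T2 := (measurableTypeR R * measurableTypeR R)%type.
Implicit Types (f g h phi psi : R * R -> R).
Variable Omega : set (R * R).
Hypothesis Omega_open : open Omega.
Let mOmega : measurable (Omega : set T2) := open_measurable2 Omega_open.

Lemma continuous_measurable_fun2 (D : set T2) f : continuous f ->
  measurable_fun D (f : T2 -> R).
Proof. by move=> cf; exact: measurable_funTS (continuous_measurable2 cf). Qed.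

Lemma measurable_fun_lin (D : set T2) (c : R) f g :
  measurable_fun D (f : T2 -> R) -> measurable_fun D (g : T2 -> R) ->
  measurable_fun D (c *: f + g : T2 -> R).
Proof.
move=> mf mg; apply: measurable_funD => //.
by apply: measurable_funM => //; exact: measurable_cst.
Qed.

Lemma integrable_lin (D : set T2) (c : R) f g : measurable D ->
  leb2.-integrable D (EFin \o f) -> leb2.-integrable D (EFin \o g) ->
  leb2.-integrable D (EFin \o (c *: f + g)).
Proof.
move=> mD i1 i2; have := integrableD mD (integrableZl mD c i1) i2.
by apply: eq_integrable => // x _ /=; rewrite EFinD EFinM.
Qed.

Lemma Rintegral_lin (D : set T2) (c : R) f g : measurable D ->
  leb2.-integrable D (EFin \o f) -> leb2.-integrable D (EFin \o g) ->
  \int[leb2]_(x in D) (c * f x + g x) =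
  c * \int[leb2]_(x in D) f x + \int[leb2]_(x in D) g x.
Proof.
move=> mD i1 i2; rewrite RintegralD ?RintegralZl//.
have := integrableZl mD c i1.
by apply: eq_integrable => // x _ /=; rewrite EFinM.
Qed.

Lemma loc_integrable_lin (c : R) f g : loc_integrable Omega f ->
  loc_integrable Omega g -> loc_integrable Omega (c *: f + g).
Proof.
move=> [mf kf] [mg kg]; split; first exact: measurable_fun_lin.
move=> K KO cK; apply: integrable_lin; first exact: compact_measurable2.
- exact: kf.
- exact: kg.
Qed.

Lemma loc_integrable_continuous f : continuous f -> loc_integrable Omega f.
Proof.
by move=> cf; split=> [|K _ cK]; [exact: continuous_measurable_fun2|exact: continuous_integrable2].
Qed.

Lemma test_continuous phi : test Omega phi -> continuous phi.
Proof. by case=> /(_ 0). Qed.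

Lemma test_differentiable phi : test Omega phi -> forall x, differentiable phi x.
Proof. by case=> /(_ 1) []. Qed.

Lemma test_out phi x : test Omega phi -> ~ Omega x -> phi x = 0.
Proof.
move=> [_ _ sphi] nx; apply/eqP; apply: contra_notT nx => h.
by apply: sphi; exact: subset_closure.
Qed.

Lemma Rintegral_test_partial j phi : test Omega phi ->
  \int[leb2]_(x in Omega) partial j phi x = 0.
Proof.
move=> tphi; have [cphi kphi sphi] := tphi.
have [M M0 KM] := compact_sub_cbox kphi.
rewrite -(@Rintegral_support _ setT) //; last first.
  by move=> x _; exact/test_out/test_partial.
apply: (@integral_partial_eq0 _ _ _ M).
- exact: test_differentiable.
- exact/test_continuous/test_partial.
- move=> x nx; apply/eqP; apply: contra_notT nx => h.
  by apply: KM; exact: subset_closure.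
Qed.

Lemma testM phi psi : test Omega phi -> test Omega psi -> test Omega (phi * psi).
Proof.
move=> [cf kf sf] [cg kg sg].
have sub : closure [set x | (phi * psi) x != 0] `<=` closure [set x | phi x != 0].
  apply: closureS => x /=; apply: contra_neq => fx.
  by have -> : (phi * psi) x = phi x * psi x by []; rewrite fx mul0r.
split; first by move=> k; exact: CkM.
- by apply: subclosed_compact sub => //; exact: closed_closure.
- exact: subset_trans sub sf.
Qed.

(** Integration by parts: the partial derivative of the test function [phi * psi] has integral 0. *)
Lemma is_weak_partial_test j phi : test Omega phi ->
  is_weak_partial Omega j phi (partial j phi).
Proof.
move=> tphi; have l1 := loc_integrable_continuous (test_continuous tphi).
have l2 := loc_integrable_continuous (test_continuous (test_partial j tphi)).
split => // psi tpsi.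
have i1 := loc_integrable_test Omega_open l1 (test_partial j tpsi).
have i2 := loc_integrable_test Omega_open l2 tpsi.
apply/eqP; rewrite -addr_eq0 -RintegralD//.
rewrite -(Rintegral_test_partial j (testM tphi tpsi)); apply/eqP.
apply: eq_Rintegral => x _; rewrite partialM; [|exact: test_differentiable..].
by rewrite [psi x * _]mulrC.
Qed.

Lemma is_weak_partial_lin j (c : R) f f' g g' : is_weak_partial Omega j f f' ->
  is_weak_partial Omega j g g' -> is_weak_partial Omega j (c *: f + g) (c *: f' + g').
Proof.
move=> [lf lf' ff'] [lg lg' gg']; split; [exact: loc_integrable_lin..|].
move=> phi tphi; have tp := test_partial j tphi.
have E (u v p : R * R -> R) : (fun x => (c *: u + v) x * p x) =
    (fun x => c * (u x * p x) + v x * p x).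
  by apply/funext => x; rewrite -[(c *: u + v) x]/(c * u x + v x); ring.
have I u p := @loc_integrable_test _ _ Omega_open u p.
rewrite !E !Rintegral_lin//; [|exact: I..].
by rewrite ff'// gg'//; ring.
Qed.

Lemma is_weak_partial_unique j f g g' : is_weak_partial Omega j f g ->
  is_weak_partial Omega j f g' -> ae_eq leb2 Omega g g'.
Proof.
move=> [lf lg fg] [_ lg' fg'].
have : ae_eq leb2 Omega (-1 *: g' + g) (cst 0).
  apply: du_bois_reymond => //; first exact: loc_integrable_lin.
  move=> phi tphi; rewrite (_ : (fun x => _) =
      fun x => -1 * (g' x * phi x) + g x * phi x); last first.
    by apply/funext => x; rewrite -[(_ + g) x]/(-1 * g' x + g x); ring.
  have I u p := @loc_integrable_test _ _ Omega_open u p.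
  rewrite Rintegral_lin//; [|exact: I..].
  by have := fg _ tphi; rewrite fg'// => /oppr_inj ->; ring.
apply: filterS => x /= gg' Ox; have := gg' Ox.
by rewrite -[(_ + g) x]/(-1 * g' x + g x) /= mulN1r addrC => /eqP; rewrite subr_eq0 => /eqP.
Qed.

Lemma wpartialP j f : (exists g, is_weak_partial Omega j f g) ->
  is_weak_partial Omega j f (wpartial Omega j f).
Proof. by move=> h; apply: (@xgetPex _ _ [set g | is_weak_partial Omega j f g] h). Qed.

(** * Sobolev spaces for a bounded nonnegative weight *)

Section Weighted.
Variables (w : R * R -> R) (M : R).
Hypothesis mw : measurable_fun (Omega : set T2) w.
Hypothesis w0 : forall x, Omega x -> 0 <= w x.
Hypothesis wM : forall x, Omega x -> w x <= M.

Lemma L2_integrable f : L2 Omega w f ->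
  leb2.-integrable (Omega : set T2) (EFin \o (fun x => f x ^+ 2 * w x)).
Proof.
move=> [mf fi]; apply/integrableP; split.
  by apply/measurable_EFinP; apply: measurable_funM => //; exact: measurable_funX.
apply: le_lt_trans fi; rewrite le_eqVlt; apply/orP; left; apply/eqP.
apply: eq_integral => x; rewrite inE => Ox /=; rewrite ger0_norm//.
by rewrite mulr_ge0 ?sqr_ge0// w0.
Qed.

Lemma integrable_L2 f : measurable_fun (Omega : set T2) f ->
  leb2.-integrable (Omega : set T2) (EFin \o (fun x => f x ^+ 2 * w x)) ->
  L2 Omega w f.
Proof.
move=> mf /integrableP[_ fi]; split => //.
apply: le_lt_trans fi; rewrite le_eqVlt; apply/orP; left; apply/eqP.
apply: eq_integral => x; rewrite inE => Ox /=; rewrite ger0_norm//.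
by rewrite mulr_ge0 ?sqr_ge0// w0.
Qed.

(** The source of all factors 2 below. This bound stands in for the triangle inequality in the
    approximation arguments, where the size of the constants is immaterial. *)
Lemma sqr_lin_le (c u v : R) : (c * u + v) ^+ 2 <= 2 * c ^+ 2 * u ^+ 2 + 2 * v ^+ 2.
Proof.
rewrite -subr_ge0; have -> : 2 * c ^+ 2 * u ^+ 2 + 2 * v ^+ 2 - (c * u + v) ^+ 2 =
  (c * u - v) ^+ 2 by ring.
exact: sqr_ge0.
Qed.

Lemma sqr_lin_weighted (c : R) f g x : Omega x ->
  (c *: f + g) x ^+ 2 * w x <=
  2 * c ^+ 2 * (f x ^+ 2 * w x) + 2 * (g x ^+ 2 * w x).
Proof.
move=> Ox; rewrite -[(c *: f + g) x]/(c * f x + g x).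
have -> : 2 * c ^+ 2 * (f x ^+ 2 * w x) + 2 * (g x ^+ 2 * w x) =
  (2 * c ^+ 2 * f x ^+ 2 + 2 * g x ^+ 2) * w x by ring.
by apply: ler_wpM2r; [exact: w0|exact: sqr_lin_le].
Qed.

Lemma L2_lin (c : R) f g : L2 Omega w f -> L2 Omega w g -> L2 Omega w (c *: f + g).
Proof.
move=> Lf Lg; have mfg := measurable_fun_lin c Lf.1 Lg.1.
apply: integrable_L2 => //.
have i2 : leb2.-integrable (Omega : set T2)
    (EFin \o ((2 * c ^+ 2) *: (fun x => f x ^+ 2 * w x) +
              (2 *: (fun x => g x ^+ 2 * w x) + cst 0))).
  apply: integrable_lin => //; first exact: L2_integrable.
  apply: integrable_lin => //; first exact: L2_integrable.
  exact: integrable0.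
apply: le_integrable i2 => //.
  by apply/measurable_EFinP; apply: measurable_funM => //; exact: measurable_funX.
move=> x Ox; rewrite lee_fin ger0_norm; last by rewrite mulr_ge0 ?sqr_ge0 ?w0.
rewrite (le_trans _ (ler_norm _))// (le_trans (sqr_lin_weighted _ _ _ Ox))//.
by rewrite -[leRHS]/(2 * c ^+ 2 * (f x ^+ 2 * w x) + (2 * (g x ^+ 2 * w x) + 0)) addr0.
Qed.

Lemma L2norm2_ge0 f : 0 <= L2norm2 Omega w f.
Proof. by apply: Rintegral_ge0 => x Ox; rewrite mulr_ge0 ?sqr_ge0 ?w0. Qed.

Lemma L2norm2_lin_le (c : R) f g : L2 Omega w f -> L2 Omega w g ->
  L2norm2 Omega w (c *: f + g) <=
  2 * c ^+ 2 * L2norm2 Omega w f + 2 * L2norm2 Omega w g.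
Proof.
move=> Lf Lg; have := L2_integrable (L2_lin c Lf Lg).
have := L2_integrable Lf; have := L2_integrable Lg => ig i_f ifg.
have E : 2 * c ^+ 2 * L2norm2 Omega w f + 2 * L2norm2 Omega w g =
   \int[leb2]_(x in Omega) (2 * c ^+ 2 * (f x ^+ 2 * w x) + (2 * (g x ^+ 2 * w x) + 0)).
  (* The trailing summand 0 lets [Rintegral_lin], which scales only its first term, be applied
     twice. *)
  have i0 : leb2.-integrable (Omega : set T2) (EFin \o (fun=> 0)) by exact: integrable0.
  rewrite Rintegral_lin//; last exact: (integrable_lin 2 mOmega ig i0).
  by rewrite Rintegral_lin// Rintegral_cst// mul0r addr0.
rewrite E; apply: le_Rintegral => //.
- have i0 : leb2.-integrable (Omega : set T2) (EFin \o (fun=> 0)) by exact: integrable0.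
  exact: (integrable_lin (2 * c ^+ 2) mOmega i_f (integrable_lin 2 mOmega ig i0)).
- by move=> x Ox; rewrite addr0; exact: sqr_lin_weighted.
Qed.

Lemma L2_ae f g : ae_eq leb2 Omega f g ->
  measurable_fun (Omega : set T2) g -> L2 Omega w f ->
  L2 Omega w g /\ L2norm2 Omega w g = L2norm2 Omega w f.
Proof.
move=> fg mg Lf; have mf := Lf.1.
have E : (\int[leb2]_(x in Omega) (f x ^+ 2 * w x)%:E =
          \int[leb2]_(x in Omega) (g x ^+ 2 * w x)%:E)%E.
  apply: ae_eq_integral => //.
  - by apply/measurable_EFinP; apply: measurable_funM => //; exact: measurable_funX.
  - by apply/measurable_EFinP; apply: measurable_funM => //; exact: measurable_funX.
  - by apply: filterS fg => x /= + Ox => ->.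
split; last by rewrite /L2norm2 /Rintegral E.
by split => //; rewrite -E; have [] := Lf.
Qed.

Lemma L2_test phi : test Omega phi -> L2 Omega w phi.
Proof.
move=> tphi; have [cphi kphi sphi] := tphi; have c0 := test_continuous tphi.
have mphi : measurable_fun (Omega : set T2) phi by exact: continuous_measurable_fun2.
apply: integrable_L2 => //.
set K := closure [set x | phi x != 0] in kphi sphi.
have nK x : ~ K x -> phi x = 0.
  by move=> nx; apply/eqP; apply: contra_notT nx => h; exact: subset_closure.
apply: (@integrable_support _ _ K) => //.
- exact: compact_measurable2.
- by move=> x _ /nK ->; rewrite expr0n mul0r.
have iK : leb2.-integrable (K : set T2) (EFin \o (fun x => phi x ^+ 2 * M)).
  apply: continuous_integrable2 => //.
  have -> : (fun x => phi x ^+ 2 * M) = M *: (phi * phi).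
    by apply/funext => x; rewrite -[(M *: _) x]/(M * (phi x * phi x)) expr2 mulrC.
  by apply: (@Ck_continuous _ 0); apply: CkZ; apply: CkM.
apply: le_integrable iK => //; first exact: compact_measurable2.
- apply/measurable_EFinP; apply: measurable_funM; last exact: measurable_funS mw.
  by apply: measurable_funX; exact: measurable_funS mphi.
- move=> x /sphi Ox; rewrite lee_fin !normrM ler_wpM2l// ger0_norm ?w0//.
  by rewrite (le_trans _ (ler_norm _))// wM.
Qed.

Lemma H1_weak f j : H1 Omega w f ->
  is_weak_partial Omega j f (wpartial Omega j f).
Proof. by case=> _ /(_ j) [h _]; exact: wpartialP. Qed.

(** Since [wpartial] is an arbitrary representative, it is linear only up to a null set. Its
    measurability is recorded separately, because almost everywhere equality does not transport it
    here. *)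
Lemma wpartial_lin_ae j (c : R) f g : H1 Omega w f -> H1 Omega w g ->
  ae_eq leb2 Omega (c *: wpartial Omega j f + wpartial Omega j g)
    (wpartial Omega j (c *: f + g)) /\
  measurable_fun (Omega : set T2) (wpartial Omega j (c *: f + g)).
Proof.
move=> Hf Hg.
have h := is_weak_partial_lin c (H1_weak j Hf) (H1_weak j Hg).
have h2 : is_weak_partial Omega j (c *: f + g) (wpartial Omega j (c *: f + g)).
  by apply: wpartialP; eexists; exact: h.
split; first exact: is_weak_partial_unique h h2.
by case: h2 => _ [].
Qed.

Lemma H1_lin (c : R) f g : H1 Omega w f -> H1 Omega w g -> H1 Omega w (c *: f + g).
Proof.
move=> Hf Hg; split; first by apply: L2_lin; [exact: Hf.1|exact: Hg.1].
move=> j; have [ae m] := wpartial_lin_ae j c Hf Hg; split.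
  eexists; exact: (is_weak_partial_lin c (H1_weak j Hf) (H1_weak j Hg)).
by apply: (L2_ae ae m _).1; apply: L2_lin; [exact: (Hf.2 j).2|exact: (Hg.2 j).2].
Qed.

Lemma H1norm2_ge0 f : 0 <= H1norm2 Omega w f.
Proof. by rewrite addr_ge0 ?sumr_ge0 ?L2norm2_ge0// => j _; exact: L2norm2_ge0. Qed.

Lemma H1norm2_lin_le (c : R) f g : H1 Omega w f -> H1 Omega w g ->
  H1norm2 Omega w (c *: f + g) <=
  2 * c ^+ 2 * H1norm2 Omega w f + 2 * H1norm2 Omega w g.
Proof.
move=> Hf Hg; rewrite /H1norm2 !mulrDr addrACA lerD//.
  by apply: L2norm2_lin_le; [exact: Hf.1|exact: Hg.1].
rewrite !mulr_sumr -big_split/=; apply: ler_sum => j _.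
have [ae m] := wpartial_lin_ae j c Hf Hg.
have L1 := (Hf.2 j).2; have L2' := (Hg.2 j).2.
rewrite (L2_ae ae m (L2_lin c L1 L2')).2; exact: L2norm2_lin_le.
Qed.

Lemma H1_test phi : test Omega phi -> H1 Omega w phi.
Proof.
move=> tphi; split; first exact: L2_test.
move=> j; have h := is_weak_partial_test j tphi; split; first by eexists; exact: h.
have h2 := wpartialP (ex_intro _ _ h).
apply: (L2_ae (is_weak_partial_unique h h2) _ _).1; first by case: h2 => _ [].
exact/L2_test/test_partial.
Qed.

Lemma H1norm2_test phi : test Omega phi -> H1norm2 Omega w phi =
  L2norm2 Omega w phi + \sum_j L2norm2 Omega w (partial j phi).
Proof.
move=> tphi; congr (_ + _); apply: eq_bigr => j _.
have h := is_weak_partial_test j tphi.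
have h2 := wpartialP (ex_intro _ _ h).
apply: (L2_ae (is_weak_partial_unique h h2) _ _).2; first by case: h2 => _ [].
exact/L2_test/test_partial.
Qed.

Lemma H10_approx f e : H10 Omega w f -> 0 < e ->
  exists2 phi, test Omega phi & H1norm2 Omega w (f - phi) < e.
Proof.
move=> [Hf af] e0; have [|phi [tphi hphi]] := af (Num.sqrt e); first by rewrite sqrtr_gt0.
exists phi => //; rewrite ltNge; apply/negP => h.
by move: hphi; rewrite ltNge ler_sqrt ?h// H1norm2_ge0.
Qed.

Lemma H10_lin (c : R) f g : H10 Omega w f -> H10 Omega w g -> H10 Omega w (c *: f + g).
Proof.
move=> Hf Hg; split; first by apply: H1_lin; [exact: Hf.1|exact: Hg.1].
(* Chosen so that the bound of [H1norm2_lin_le] becomes 2 c^2 d + 2 d = e^2. *)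
move=> e e0; pose d := e ^+ 2 / (2 * c ^+ 2 + 2).
have c2 := sqr_ge0 c.
have D2 : 0 < 2 * c ^+ 2 + 2 by lra.
have d0 : 0 < d by rewrite divr_gt0 ?exprn_gt0.
have [phi tphi hphi] := H10_approx Hf d0.
have [psi tpsi hpsi] := H10_approx Hg d0.
exists (c *: phi + psi); split; first by apply: testD => //; exact: testZ.
have sub u p : H1 Omega w u -> test Omega p -> H1 Omega w (u - p).
  move=> Hu tp; have -> : u - p = -1 *: p + u by rewrite scaleN1r addrC.
  exact: (H1_lin _ (H1_test tp) Hu).
have -> : c *: f + g - (c *: phi + psi) = c *: (f - phi) + (g - psi).
  by rewrite scalerBr addrACA opprD.
rewrite -[X in _ < X](gtr0_norm e0) -sqrtr_sqr ltr_sqrt ?exprn_gt0//.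
apply: le_lt_trans (H1norm2_lin_le _ (sub _ _ Hf.1 tphi) (sub _ _ Hg.1 tpsi)) _.
have -> : e ^+ 2 = 2 * c ^+ 2 * d + 2 * d.
  by rewrite -mulrDl /d mulrC (divfK (lt0r_neq0 D2)).
move: (H1norm2 _ _ (f - phi)) (H1norm2 _ _ (g - psi)) hphi hpsi => A B hA hB.
apply: ler_ltD; last by rewrite ltr_pM2l.
by apply: ler_wpM2l; [exact: mulr_ge0|exact: ltW].
Qed.

Lemma H10_sub_test f phi : H10 Omega w f -> test Omega phi -> H1 Omega w (f - phi).
Proof.
move=> [Hf _] tp; have -> : f - phi = -1 *: phi + f by rewrite scaleN1r addrC.
exact: (H1_lin _ (H1_test tp) Hf).
Qed.

(** Where [w] is at least 1/(n+1), the unweighted square of f - phi is at most n+1 times the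
    weighted one, and phi obeys the assumed inequality. The factor n+1 multiplies only a term that
    vanishes as phi tends to f with n fixed. *)
Lemma sublevel_Rintegral_le f (n : nat) (C : R) phi : test Omega phi ->
  0 <= C -> H10 Omega w f ->
  \int[leb2]_(x in Omega) (phi x ^+ 2) <= C * H1norm2 Omega w phi ->
  (\int[leb2]_(x in Omega `&` [set x | (n.+1%:R^-1 <= w x)%R]) (f x ^+ 2)%:E <=
  (2 * n.+1%:R * H1norm2 Omega w (f - phi) + 2 * C * H1norm2 Omega w phi)%:E)%E.
Proof.
move=> tphi C0 Hf hphi; set E := _ `&` _.
have mE : measurable (E : set T2).
  rewrite /E (_ : [set x | _] = [set x | `[n.+1%:R^-1, +oo[%classic (w x)]).
    by apply: (mw mOmega); exact: measurable_itv.
  by apply/seteqP; split => x /=; rewrite in_itv/= andbT.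
have EO : E `<=` Omega by move=> x [].
have Hs := H10_sub_test Hf tphi.
have i1 := L2_integrable Hs.1.
have i2 : leb2.-integrable (Omega : set T2) (EFin \o (fun x => phi x ^+ 2)).
  have := loc_integrable_test Omega_open
    (loc_integrable_continuous (test_continuous tphi)) tphi.
  by apply: eq_integrable => // x _ /=; rewrite expr2.
pose G : R * R -> R := (2 * n.+1%:R) *: (fun x => (f - phi) x ^+ 2 * w x) +
  (2 *: (fun x => phi x ^+ 2) + cst 0).
have i0 : leb2.-integrable (Omega : set T2) (EFin \o (fun=> 0)) by exact: integrable0.
have iG : leb2.-integrable (Omega : set T2) (EFin \o G).
  exact: (integrable_lin (2 * n.+1%:R) mOmega i1 (integrable_lin 2 mOmega i2 i0)).
have GE x : G x = 2 * n.+1%:R * ((f - phi) x ^+ 2 * w x) + 2 * phi x ^+ 2.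
  by rewrite -[LHS]/(2 * n.+1%:R * ((f - phi) x ^+ 2 * w x) +
    (2 * (phi x ^+ 2) + 0)) addr0.
have G0 x : Omega x -> 0 <= G x.
  move=> Ox; rewrite GE; apply: addr_ge0; apply: mulr_ge0 => //.
  - by apply: mulr_ge0; [exact: sqr_ge0|exact: w0].
  - exact: sqr_ge0.
have mG : measurable_fun (Omega : set T2) (EFin \o G) by exact: measurable_int iG.
have mf : measurable_fun (Omega : set T2) f by exact: Hf.1.1.1.
apply: (@le_trans _ _ (\int[leb2]_(x in E) (G x)%:E)%E).
  apply: ge0_le_integral => //.
  - by move=> x _; rewrite lee_fin sqr_ge0.
  - apply/measurable_EFinP; apply: measurable_funX; exact: measurable_funS mf.
  - by apply: measurable_funS mG.
  - move=> x [Ox /= wx]; rewrite lee_fin GE.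
    have fE : f x = (f - phi) x + phi x.
      by rewrite -[(f - phi) x]/(f x - phi x) subrK.
    have := sqr_lin_le 1 ((f - phi) x) (phi x); rewrite mul1r -fE => /le_trans; apply.
    rewrite lerD2r expr1n mulr1 -mulrA ler_wpM2l// mulrCA ler_peMr ?sqr_ge0//.
    by rewrite mulrC -ler_pdivrMr// div1r.
apply: (@le_trans _ _ (\int[leb2]_(x in Omega) (G x)%:E)%E).
  by apply: ge0_subset_integral => // x /G0; rewrite lee_fin.
rewrite -[leLHS]fineK; last exact: integrable_fin_num.
rewrite lee_fin -[leLHS]/(\int[leb2]_(x in Omega) G x).
rewrite (_ : Rintegral _ _ _ = 2 * n.+1%:R * L2norm2 Omega w (f - phi) +
  2 * \int[leb2]_(x in Omega) (phi x ^+ 2)); last first.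
  rewrite /G /L2norm2 Rintegral_lin//; last exact: (integrable_lin 2 mOmega i2 i0).
  by rewrite Rintegral_lin// Rintegral_cst// mul0r addr0.
apply: lerD; last by rewrite -mulrA ler_wpM2l.
by rewrite ler_wpM2l// /H1norm2 lerDl sumr_ge0// => j _; exact: L2norm2_ge0.
Qed.

(** For fixed n, letting phi tend to f in the weighted norm leaves a bound free of n. Monotone
    convergence then exhausts [Omega] up to the null set where [w] is 0. The factor 4 combines the 2
    of [sublevel_Rintegral_le] with the 2 from comparing the norms of phi and f. *)
Lemma H10_sqr_integrable f (C : R) : 0 <= C ->
  (forall phi, test Omega phi ->
     \int[leb2]_(x in Omega) (phi x ^+ 2) <= C * H1norm2 Omega w phi) ->
  leb2 (Omega `&` [set x | w x = 0]) = 0%E ->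
  H10 Omega w f ->
  (\int[leb2]_(x in Omega) (f x ^+ 2)%:E <= (4 * C * H1norm2 Omega w f)%:E)%E.
Proof.
move=> C0 hC Z0 Hf; set N := H1norm2 Omega w f.
have mf : measurable_fun (Omega : set T2) f by exact: Hf.1.1.1.
have mE (S : set R) : measurable S -> measurable (Omega `&` [set x | S (w x)] : set T2).
  by move=> mS; exact: (mw mOmega mS).
pose E n := Omega `&` [set x | n.+1%:R^-1 <= w x].
have mEn n : measurable (E n : set T2).
  rewrite /E (_ : [set x | _] = [set x | `[n.+1%:R^-1, +oo[%classic (w x)]).
    by apply: mE; exact: measurable_itv.
  by apply/seteqP; split => x /=; rewrite in_itv/= andbT.
have En n : (\int[leb2]_(x in E n) (f x ^+ 2)%:E <= (4 * C * N)%:E)%E.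
  apply/lee_addgt0Pr => e e0.
  pose d := e / (2 * n.+1%:R + 4 * C + 1).
  have n0 : 0 <= n.+1%:R :> R by [].
  have D0 : 0 < 2 * n.+1%:R + 4 * C + 1 by lra.
  have d0 : 0 < d by rewrite divr_gt0.
  have [phi tphi hphi] := H10_approx Hf d0.
  apply: le_trans (sublevel_Rintegral_le n tphi C0 Hf (hC _ tphi)) _.
  rewrite -EFinD lee_fin.
  have phiE : phi = -1 *: (f - phi) + f by rewrite scaleN1r opprB subrK.
  have h2 : H1norm2 Omega w phi <= 2 * H1norm2 Omega w (f - phi) + 2 * N.
    rewrite {1}phiE.
    apply: le_trans (H1norm2_lin_le (-1) (H10_sub_test Hf tphi) Hf.1) _.
    by rewrite sqrrN expr1n mulr1.
  set a := H1norm2 Omega w (f - phi) in hphi h2 *.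
  have a0 : 0 <= a by exact: H1norm2_ge0.
  have hd : d * (2 * n.+1%:R + 4 * C + 1) = e by rewrite /d divfK// gt_eqF.
  have h3 : 2 * C * H1norm2 Omega w phi <= 2 * C * (2 * a + 2 * N).
    by rewrite ler_wpM2l// mulr_ge0.
  have h4 : 2 * n.+1%:R * a <= 2 * n.+1%:R * d by rewrite ler_wpM2l ?mulr_ge0// ltW.
  have h5 : 4 * C * a <= 4 * C * d by rewrite ler_wpM2l ?mulr_ge0// ltW.
  by rewrite -hd; lra.
have Zm : measurable (Omega `&` [set x | w x = 0] : set T2).
  by apply: (mE [set 0]); exact: measurable_set1.
rewrite (ge0_negligible_integral Zm)//; last 2 first.
- by apply/measurable_EFinP; exact: measurable_funX.
- by move=> x _; rewrite lee_fin sqr_ge0.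
have -> : Omega `\` (Omega `&` [set x | w x = 0]) = \bigcup_n E n.
  apply/seteqP; split => [x [Ox nx]|x [n _ [Ox /= wx]]].
    have wx : 0 < w x by rewrite lt_neqAle w0// andbT eq_sym; apply/eqP => h; apply: nx.
    exists (Num.bound (w x)^-1) => //; split => //=.
    rewrite -[leRHS]invrK lef_pV2 ?posrE ?invr_gt0//.
    apply: le_trans (ltW (archi_boundP _)) _; first by rewrite invr_ge0 ltW.
    by rewrite ler_nat.
  by split => // -[_ /= w0']; move: wx; rewrite w0' leNgt invr_gt0 ltr0n.
have cvg : (\int[leb2]_(x in E n) (f x ^+ 2)%:E @[n --> \oo] -->
            \int[leb2]_(x in \bigcup_n E n) (f x ^+ 2)%:E)%E.
  apply: ge0_nondecreasing_set_cvg_integral => //.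
  - apply/nondecreasing_seqP => n; apply/subsetPset => x [Ox /= wx]; split => //=.
    by apply: le_trans wx; rewrite lef_pV2 ?posrE// ler_nat.
  - move=> n; apply/measurable_EFinP; apply: measurable_funX.
    by apply: measurable_funS mf => // x [].
  - by move=> n x _; rewrite lee_fin sqr_ge0.
apply: (cvge_le _ cvg); exact: nearW.
Qed.

End Weighted.

End WeakPartial.

(** * A Hardy-type inequality *)

Section Hardy.
Context {R : realType}.
Local Notation T2 := (measurableTypeR R * measurableTypeR R)%type.
Implicit Types (f g h phi psi : R * R -> R) (p q : {poly R}).
Variable Omega : set (R * R).
Hypothesis Omega_open : open Omega.
Let mOmega : measurable (Omega : set T2) := open_measurable2 Omega_open.

Lemma continuous_bounded_itv (h : R -> R) (L : R) : continuous h ->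
  exists2 B, 0 < B & forall s, `|s| <= L -> `|h s| <= B.
Proof.
move=> ch; have : compact (h @` `[(- L), L]).
  apply: continuous_compact; last exact: segment_compact.
  exact: continuous_subspaceT.
move=> /compact_bounded [M0 [_ M0K]].
have M1 : M0 < `|M0| + 1 by rewrite (le_lt_trans (ler_norm _))// ltrDl.
exists (`|M0| + 1); first by rewrite ltr_pwDr.
by move=> s sL; apply: (M0K _ M1); exists s => //=; rewrite in_itv/= -ler_norml.
Qed.

(* Completing squares; the factor of [K] is the derivative of [p p' y^2]. *)
Lemma hardy_pointwise (B m p p1 p2 u v y z : R) (K := 4 * m ^+ 2) :
  `|p1| <= B -> `|p2| <= B -> `|u| <= m -> `|v| <= m -> u * p + v * p1 = 1 ->
  y ^+ 2 <= (4 * m ^+ 2 + 2 * K ^+ 2 * B ^+ 2) * (p ^+ 2 * (y ^+ 2 + z ^+ 2)) +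
    K * ((p1 ^+ 2 + p * p2) * y ^+ 2 + 2 * (p * p1 * y * z)).
Proof.
move=> hp1 hp2 hu hv uv.
have sq (a b : R) : `|a| <= b -> a ^+ 2 <= b ^+ 2.
  by move=> ab; rewrite -[a ^+ 2]real_normK ?num_real// ler_pXn2r ?nnegrE// (le_trans _ ab).
have {}hp1 := sq _ _ hp1; have {}hp2 := sq _ _ hp2.
have {}hu := sq _ _ hu; have {}hv := sq _ _ hv.
have y2 := sqr_ge0 y; have z2 := sqr_ge0 z.
(* Squaring the Bezout relation shows that p^2 + p1^2 is bounded away from 0. *)
have h1 : 1 <= 2 * m ^+ 2 * (p ^+ 2 + p1 ^+ 2).
  have a1 : u ^+ 2 * p ^+ 2 <= m ^+ 2 * p ^+ 2 by rewrite ler_wpM2r ?sqr_ge0.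
  have a2 : v ^+ 2 * p1 ^+ 2 <= m ^+ 2 * p1 ^+ 2 by rewrite ler_wpM2r ?sqr_ge0.
  have a3 := sqr_ge0 (u * p - v * p1).
  have a4 : (u * p + v * p1) ^+ 2 = 1 by rewrite uv expr1n.
  have a5 : (u * p + v * p1) ^+ 2 + (u * p - v * p1) ^+ 2 =
    2 * (u ^+ 2 * p ^+ 2) + 2 * (v ^+ 2 * p1 ^+ 2) by ring.
  have -> : 2 * m ^+ 2 * (p ^+ 2 + p1 ^+ 2) = 2 * (m ^+ 2 * p ^+ 2) + 2 * (m ^+ 2 * p1 ^+ 2) by ring.
  lra.
have s3 (a b c : R) : 0 <= a ^+ 2 * b ^+ 2 * c ^+ 2.
  by apply: mulr_ge0; [apply: mulr_ge0|]; exact: sqr_ge0.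
(* Two copies of y^2 are gained. One is the left-hand side; the halves of the other absorb the two
   terms of indefinite sign, by the squares in [h2] and [h3]. *)
have h1y : 2 * y ^+ 2 <= K * (p ^+ 2 + p1 ^+ 2) * y ^+ 2.
  rewrite ler_wpM2r// /K; move: h1; set a := p ^+ 2 + p1 ^+ 2.
  have -> : 4 * m ^+ 2 * a = 2 * (2 * m ^+ 2 * a) by ring.
  lra.
have h2 : 0 <= (1 + K * (p * p2)) ^+ 2 * y ^+ 2 by apply: mulr_ge0; exact: sqr_ge0.
have h2' : K ^+ 2 * p ^+ 2 * y ^+ 2 * p2 ^+ 2 <= K ^+ 2 * p ^+ 2 * y ^+ 2 * B ^+ 2.
  exact: ler_wpM2l.
have h3 := sqr_ge0 (y + 2 * K * (p * p1) * z).
have h3' : K ^+ 2 * p ^+ 2 * z ^+ 2 * p1 ^+ 2 <= K ^+ 2 * p ^+ 2 * z ^+ 2 * B ^+ 2.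
  exact: ler_wpM2l.
have h4 : 0 <= K ^+ 2 * p ^+ 2 * y ^+ 2 * B ^+ 2.
  by apply: mulr_ge0 => //; exact: sqr_ge0.
have h5 : 0 <= m ^+ 2 * p ^+ 2 * z ^+ 2 by [].
have e2 : (1 + K * (p * p2)) ^+ 2 * y ^+ 2 =
  y ^+ 2 + 2 * (K * (p * p2 * y ^+ 2)) + K ^+ 2 * p ^+ 2 * y ^+ 2 * p2 ^+ 2 by ring.
have e3 : (y + 2 * K * (p * p1) * z) ^+ 2 =
  y ^+ 2 + 4 * (K * (p * p1 * y * z)) + 4 * (K ^+ 2 * p ^+ 2 * z ^+ 2 * p1 ^+ 2) by ring.
rewrite -subr_ge0.
have -> : (4 * m ^+ 2 + 2 * K ^+ 2 * B ^+ 2) * (p ^+ 2 * (y ^+ 2 + z ^+ 2)) +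
    K * ((p1 ^+ 2 + p * p2) * y ^+ 2 + 2 * (p * p1 * y * z)) - y ^+ 2 =
  K * (p ^+ 2 + p1 ^+ 2) * y ^+ 2 + 4 * (m ^+ 2 * p ^+ 2 * z ^+ 2) +
  2 * (K ^+ 2 * p ^+ 2 * y ^+ 2 * B ^+ 2) + 2 * (K ^+ 2 * p ^+ 2 * z ^+ 2 * B ^+ 2) +
  K * (p * p2 * y ^+ 2) + 2 * (K * (p * p1 * y * z)) - y ^+ 2 by rewrite /K; ring.
rewrite e2 in h2; rewrite e3 in h3.
lra.
Qed.

Lemma continuous_horner1 p : Ck 0 (fun x : R * R => p.[x.1]).
Proof.
move=> x; apply: (@continuous_comp _ _ _ (fun x : R * R => x.1) (horner p)).
- exact: cvg_fst.
- exact: continuous_horner.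
Qed.

Lemma integrable_CkM_test h phi : Ck 0 h -> test Omega phi ->
  leb2.-integrable (Omega : set T2) (EFin \o (fun x => h x * phi x)).
Proof. by move=> ch; apply: loc_integrable_test => //; exact: loc_integrable_continuous. Qed.

(** The integrand is the derivative of q q' phi^2 in the first coordinate. *)
Lemma integral_poly_test_eq0 q phi : test Omega phi ->
  \int[leb2]_(x in Omega)
    ((((q^`()).[x.1] ^+ 2 + q.[x.1] * (q^`()^`()).[x.1]) * phi x
      + 2 * (q.[x.1] * (q^`()).[x.1] * partial 0 phi x)) * phi x) = 0.
Proof.
move=> tphi; have [cphi kphi sphi] := tphi.
pose r := q * q^`().
(* The argument is written as an affine function to match [partial_comp1]. *)
pose G : R * R -> R := fun x => r.[1 * x.1 + 0].
have GE x : G x = r.[x.1] by rewrite /G mul1r addr0.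
have dG x : differentiable G x by apply: differentiable_comp1; exact: derivable_horner.
have pG x : partial 0 G x = (r^`()).[x.1].
  rewrite /G (@partial_comp1 _ (horner r) 1 0); last exact: derivable_horner.
  by rewrite eqxx -derivE mulr1 mul1r addr0.
have dphi := test_differentiable tphi.
have pF x : partial 0 (G * (phi * phi)) x =
    (((q^`()).[x.1] ^+ 2 + q.[x.1] * (q^`()^`()).[x.1]) * phi x
      + 2 * (q.[x.1] * (q^`()).[x.1] * partial 0 phi x)) * phi x.
  rewrite partialM//; last exact: differentiableM.
  rewrite partialM// pG GE /r derivM hornerD !hornerM.
  by rewrite -[(phi * phi) x]/(phi x * phi x); ring.
have F0 x : ~ Omega x -> phi x = 0 by exact: test_out.
rewrite -(@Rintegral_support _ setT) //; last by move=> x _ /F0 ->; rewrite mulr0.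
have [M M0 KM] := compact_sub_cbox kphi.
rewrite -(@integral_partial_eq0 _ 0 (G * (phi * phi)) M).
- by apply: eq_Rintegral => x _; rewrite pF.
- by move=> x; apply: differentiableM => //; exact: differentiableM.
- have -> : partial 0 (G * (phi * phi)) = (((fun x => (q^`()).[x.1]) * (fun x => (q^`()).[x.1])
     + (fun x => q.[x.1]) * (fun x => (q^`()^`()).[x.1])) * phi
      + 2 *: ((fun x => q.[x.1]) * (fun x => (q^`()).[x.1]) * partial 0 phi)) * phi.
    apply/funext => x; rewrite pF expr2; reflexivity.
  have c1 : Ck 0 (partial 0 phi) by have [_ /(_ 0)] := cphi 1.
  have c0 := cphi 0; have cp := continuous_horner1.
  apply: (@CkM _ 0) => //; apply: (@CkD _ 0).
    by apply: (@CkM _ 0) => //; apply: (@CkD _ 0); exact: (@CkM _ 0).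
  by apply: (@CkZ _ 0); apply: (@CkM _ 0) => //; exact: (@CkM _ 0).
- move=> x nx; rewrite -[LHS]/(G x * (phi x * phi x)).
  suff -> : phi x = 0 by rewrite !mulr0.
  by apply/eqP; apply: contra_notT nx => h; apply: KM; exact: subset_closure.
Qed.

(** Integrate [hardy_pointwise] with Bezout coefficients u, v of q and q': the term with factor [K]
    has integral 0. All polynomials involved are bounded because [Omega] is. *)
Lemma hardy_test q : bounded_set Omega -> coprimep q q^`() ->
  exists2 C, 0 <= C & forall phi, test Omega phi ->
    \int[leb2]_(x in Omega) (phi x ^+ 2) <=
    C * (\int[leb2]_(x in Omega) (q.[x.1] ^+ 2 * (phi x ^+ 2 + partial 0 phi x ^+ 2))).
Proof.
move=> bO /Bezout_eq1_coprimepP [[u v] /= uv].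
have [L L0 OL] := bounded_sub_cbox bO.
have [B1 B10 hB1] := continuous_bounded_itv L (@continuous_horner _ q^`()).
have [B2 B20 hB2] := continuous_bounded_itv L (@continuous_horner _ q^`()^`()).
have [m1 m10 hm1] := continuous_bounded_itv L (@continuous_horner _ u).
have [m2 m20 hm2] := continuous_bounded_itv L (@continuous_horner _ v).
pose B := B1 + B2; pose m := m1 + m2; pose K := 4 * m ^+ 2.
exists (4 * m ^+ 2 + 2 * K ^+ 2 * B ^+ 2).
  apply: addr_ge0; first by apply: mulr_ge0 => //; exact: sqr_ge0.
  by apply: mulr_ge0; [apply: mulr_ge0 => //|]; exact: sqr_ge0.
move=> phi tphi; set C := 4 * _ + _.
have cp := continuous_horner1.
have [cphi _ _] := tphi.
have tp := test_partial 0 tphi.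
pose f1 : R * R -> R := fun x => q.[x.1] ^+ 2 * (phi x ^+ 2 + partial 0 phi x ^+ 2).
pose f2 : R * R -> R := fun x => (((q^`()).[x.1] ^+ 2 + q.[x.1] * (q^`()^`()).[x.1]) * phi x
      + 2 * (q.[x.1] * (q^`()).[x.1] * partial 0 phi x)) * phi x.
have i0 : leb2.-integrable (Omega : set T2) (EFin \o (fun x => phi x ^+ 2)).
  have := integrable_CkM_test (cphi 0) tphi.
  by apply: eq_integrable => // x _ /=; rewrite expr2.
have i1 : leb2.-integrable (Omega : set T2) (EFin \o f1).
  have cq : Ck 0 (fun x : R * R => q.[x.1] * q.[x.1]) := @CkM _ 0 _ _ (cp q) (cp q).
  have j1 := integrable_CkM_test (@CkM _ 0 _ _ cq (cphi 0)) tphi.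
  have j2 := integrable_CkM_test (@CkM _ 0 _ _ cq (test_continuous tp)) tp.
  have := integrable_lin 1 mOmega j1 j2.
  apply: eq_integrable => // x _; congr EFin; rewrite /f1.
  transitivity (1 * (q.[x.1] * q.[x.1] * phi x * phi x) +
     q.[x.1] * q.[x.1] * partial 0 phi x * partial 0 phi x); first by [].
  by ring.
have i2 : leb2.-integrable (Omega : set T2) (EFin \o f2).
  apply: integrable_CkM_test => //.
  have := @CkD _ 0 _ _ (@CkM _ 0 _ _ (@CkD _ 0 _ _ (@CkM _ 0 _ _ (cp q^`()) (cp q^`()))
     (@CkM _ 0 _ _ (cp q) (cp q^`()^`()))) (cphi 0))
     (@CkZ _ 0 2 _ (@CkM _ 0 _ _ (@CkM _ 0 _ _ (cp q) (cp q^`())) (test_continuous tp))).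
  by congr (Ck 0 _); apply/funext => x; rewrite expr2.
have pw x : Omega x -> phi x ^+ 2 <= C * f1 x + K * f2 x.
  move=> /OL [/=]; rewrite !in_itv/= -!ler_norml => x1 _.
  have := @hardy_pointwise B m q.[x.1] (q^`()).[x.1] (q^`()^`()).[x.1] u.[x.1] v.[x.1]
    (phi x) (partial 0 phi x).
  rewrite -/K -/C => H; rewrite (le_trans (H _ _ _ _ _))//.
  - by rewrite (le_trans (hB1 _ x1))// lerDl ltW.
  - by rewrite (le_trans (hB2 _ x1))// lerDr ltW.
  - by rewrite (le_trans (hm1 _ x1))// lerDl ltW.
  - by rewrite (le_trans (hm2 _ x1))// lerDr ltW.
  - by rewrite -!hornerM -hornerD uv hornerC.
  - rewrite /f1 /f2 lerD2l le_eqVlt; apply/orP; left; apply/eqP; congr (K * _); ring.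
have E : C * \int[leb2]_(x in Omega) f1 x = \int[leb2]_(x in Omega) (C * f1 x + (K * f2 x + 0)).
  have z : leb2.-integrable (Omega : set T2) (EFin \o (fun=> 0)) by exact: integrable0.
  rewrite Rintegral_lin//; last exact: (integrable_lin K mOmega i2 z).
  by rewrite Rintegral_lin// Rintegral_cst// mul0r addr0 integral_poly_test_eq0// mulr0 addr0.
rewrite E; apply: le_Rintegral => //; last by move=> x Ox; rewrite addr0; exact: pw.
have z : leb2.-integrable (Omega : set T2) (EFin \o (fun=> 0)) by exact: integrable0.
exact: (integrable_lin C mOmega i1 (integrable_lin K mOmega i2 z)).
Qed.

Lemma hardy_weighted q (w : R * R -> R) (M k : R) : bounded_set Omega ->
  measurable_fun (Omega : set T2) w -> (forall x, Omega x -> 0 <= w x) ->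
  (forall x, Omega x -> w x <= M) -> 0 <= k ->
  (forall x, Omega x -> q.[x.1] ^+ 2 <= k * w x) -> coprimep q q^`() ->
  exists2 C, 0 <= C & forall phi, test Omega phi ->
    \int[leb2]_(x in Omega) (phi x ^+ 2) <= C * H1norm2 Omega w phi.
Proof.
move=> bO mw w0 wM k0 qw cq; have [C C0 hC] := hardy_test bO cq.
exists (C * k); first exact: mulr_ge0.
move=> phi tphi; apply: le_trans (hC _ tphi) _.
rewrite -mulrA ler_wpM2l// (H1norm2_test Omega_open mw w0 wM tphi).
have tp := test_partial 0 tphi.
have L1 := L2_integrable mw w0 (L2_test Omega_open mw w0 wM tphi).
have L2' := L2_integrable mw w0 (L2_test Omega_open mw w0 wM tp).
have i0 : leb2.-integrable (Omega : set T2) (EFin \o (fun=> 0)) by exact: integrable0.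
apply: (@le_trans _ _ (k * L2norm2 Omega w phi + (k * L2norm2 Omega w (partial 0 phi) + 0))).
  have -> : k * L2norm2 Omega w phi + (k * L2norm2 Omega w (partial 0 phi) + 0) =
      \int[leb2]_(x in Omega) (k * (phi x ^+ 2 * w x) + (k * (partial 0 phi x ^+ 2 * w x) + 0)).
    rewrite Rintegral_lin//; last exact: (integrable_lin k mOmega L2' i0).
    by rewrite Rintegral_lin// Rintegral_cst// mul0r.
  have iR := integrable_lin k mOmega L1 (integrable_lin k mOmega L2' i0).
  have pw x : Omega x -> q.[x.1] ^+ 2 * (phi x ^+ 2 + partial 0 phi x ^+ 2) <=
      k * (phi x ^+ 2 * w x) + (k * (partial 0 phi x ^+ 2 * w x) + 0).
    move=> Ox; have -> : k * (phi x ^+ 2 * w x) + (k * (partial 0 phi x ^+ 2 * w x) + 0) =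
      k * w x * (phi x ^+ 2 + partial 0 phi x ^+ 2) by ring.
    by apply: ler_wpM2r; [rewrite addr_ge0 ?sqr_ge0|exact: qw].
  apply: le_Rintegral => //.
  apply: le_integrable iR => //.
    apply/measurable_EFinP; apply: measurable_funM.
      apply: measurable_funX; apply: continuous_measurable_fun2; exact: continuous_horner1.
    by apply: measurable_funD; apply: measurable_funX; apply: continuous_measurable_fun2;
      exact: (test_continuous (Omega := Omega)).
  move=> x Ox; rewrite lee_fin ger0_norm; last first.
    by rewrite mulr_ge0 ?addr_ge0 ?sqr_ge0.
  exact: le_trans (pw x Ox) (ler_norm _).
rewrite addr0 -mulrDr ler_wpM2l// lerD2l (bigD1 0)//= lerDl sumr_ge0// => j _.
exact: L2norm2_ge0.
Qed.

End Hardy.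

(** * The weight rho *)

Section Rho.
Context {R : realType}.
Local Notation T2 := (measurableTypeR R * measurableTypeR R)%type.
Variables (Omega : set (R * R)) (l : nat) (D : 'I_l -> R * R) (alpha : R).
Hypothesis Omega_open : open Omega.
Hypothesis Omega_bounded : bounded_set Omega.
Hypothesis alpha02 : 0 < alpha < 2.
Let mOmega : measurable (Omega : set T2) := open_measurable2 Omega_open.
Local Notation rho := (rho Omega D alpha).

Lemma edist_continuous (y : R * R) : continuous (fun x => edist x y).
Proof.
move=> x; apply: (@continuous_comp _ _ _ (fun x : R * R =>
   (x.1 - y.1) ^+ 2 + (x.2 - y.2) ^+ 2) Num.sqrt); last exact: sqrt_continuous.
apply: differentiable_continuous; apply: differentiableD.
- have := @differentiable_coord1 R 1 (- y.1) x => d1.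
  have := differentiableM d1 d1; congr (differentiable _ _); apply/funext => z.
  by rewrite -[LHS]/((1 * z.1 + - y.1) * (1 * z.1 + - y.1)) mul1r expr2.
- have := @differentiable_coord2 R 1 (- y.2) x => d1.
  have := differentiableM d1 d1; congr (differentiable _ _); apply/funext => z.
  by rewrite -[LHS]/((1 * z.2 + - y.2) * (1 * z.2 + - y.2)) mul1r expr2.
Qed.

Lemma edist_ge0 (x y : R * R) : 0 <= edist x y.
Proof. exact: sqrtr_ge0. Qed.

Lemma edist_eq0 (x y : R * R) : edist x y = 0 -> x = y.
Proof.
move=> /eqP; rewrite sqrtr_eq0 => h.
have h1 := sqr_ge0 (x.1 - y.1); have h2 := sqr_ge0 (x.2 - y.2).
have /eqP e1 : (x.1 - y.1) ^+ 2 = 0 by lra.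
have /eqP e2 : (x.2 - y.2) ^+ 2 = 0 by lra.
move: e1 e2; rewrite !sqrf_eq0 !subr_eq0 => /eqP e1 /eqP e2.
by rewrite [x]surjective_pairing [y]surjective_pairing e1 e2.
Qed.

Lemma edist_ge1 (x y : R * R) : `|x.1 - y.1| <= edist x y.
Proof.
by rewrite -sqrtr_sqr ler_wsqrtr// lerDl sqr_ge0.
Qed.

Lemma edist_bounded (y : R * R) :
  exists2 E, 0 < E & forall x, Omega x -> edist x y <= E.
Proof.
have [L L0 OL] := bounded_sub_cbox Omega_bounded.
have : compact ((fun x => edist x y) @` cbox (- L) L (- L) L).
  apply: continuous_compact; last exact: compact_cbox.
  exact/continuous_subspaceT/edist_continuous.
move=> /compact_bounded [M0 [_ M0K]].
have M1 : M0 < `|M0| + 1 by rewrite (le_lt_trans (ler_norm _))// ltrDl.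
exists (`|M0| + 1); first by rewrite ltr_pwDr.
move=> x Ox; apply: le_trans (ler_norm _) _; apply: (M0K _ M1).
by exists x => //; exact: OL.
Qed.

(** [pick] returns the first suitable index of the enumeration, so the function is a finite nest of
    conditionals, built by induction on that list. *)
Lemma measurable_pick (I : finType) (P : I -> R * R -> bool)
    (F : I -> R * R -> R) (c : R) :
  (forall i, measurable_fun (setT : set T2) (P i : T2 -> bool)) ->
  (forall i, measurable_fun (setT : set T2) (F i : T2 -> R)) ->
  measurable_fun (setT : set T2)
    (fun x : T2 => if [pick i | P i x] is Some i then F i x else c).
Proof.
move=> mP mF; rewrite /pick /enum_mem.
elim: (Finite.enum I) => [|i s IH] /=; first exact: measurable_cst.
rewrite (_ : (fun x : T2 => _) = (fun x : T2 => if P i x then F i x else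
  if ohead [seq i <- s | P i x] is Some i then F i x else c)).
  exact: measurable_fun_ifT.
by apply/funext => x; rewrite -topredE /=; case: ifP.
Qed.

Lemma measurable_rho : measurable_fun (Omega : set T2) rho.
Proof.
apply: measurable_funTS; apply: measurable_pick => i.
  have [l1|l1] := boolP (l == 1%N); first exact: measurable_cst.
  apply: measurable_fun_ltr; last exact: measurable_cst.
  apply: (@continuous_measurable2 _ (fun x => edist x (D i))).
  exact: edist_continuous.
apply: (measurableT_comp (measurable_powR alpha)).
apply: (@continuous_measurable2 _ (fun x => edist x (D i))).
exact: edist_continuous.
Qed.

Lemma rho_ge0 x : 0 <= rho x.
Proof. by rewrite /Defs.rho; case: pickP => [i _|_//]; exact: powR_ge0. Qed.

Lemma rho_bounded : exists M, forall x, Omega x -> rho x <= M.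
Proof.
have /choice [E hE] : forall i, exists E, 0 < E /\ forall x, Omega x -> edist x (D i) <= E.
  by move=> i; have [E E0 h] := edist_bounded (D i); exists E.
exists (\sum_i E i `^ alpha + 1) => x Ox.
have S0 (P : pred 'I_l) : 0 <= \sum_(i | P i) E i `^ alpha.
  by apply: sumr_ge0 => i _; exact: powR_ge0.
rewrite /Defs.rho; case: pickP => [i _|_]; last by rewrite lerDr.
rewrite (bigD1 i)//= -addrA; apply: le_trans (_ : E i `^ alpha <= _).
  have [E0 h] := hE i; apply: ge0_ler_powR; rewrite ?nnegrE ?edist_ge0//.
  - by have /andP[/ltW] := alpha02.
  - exact: ltW.
  - exact: h.
by rewrite lerDl addr_ge0.
Qed.

Lemma point_setX (p : R * R) : [set p] = [set p.1] `*` [set p.2].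
Proof.
apply/seteqP; split => [x -> //|[x y] [/= -> ->]].
by rewrite -surjective_pairing.
Qed.

Lemma measurable_point (p : R * R) : measurable ([set p] : set T2).
Proof. by rewrite point_setX; apply: measurableX; exact: measurable_set1. Qed.

Lemma leb2_point (p : R * R) : leb2 [set p] = 0%E.
Proof.
rewrite point_setX.
have -> : leb2 ([set p.1] `*` [set p.2]) =
    (lebesgue_measure [set p.1] * lebesgue_measure [set p.2])%E.
  by apply: product_measure1E; exact: measurable_set1.
by rewrite lebesgue_measure_set1 mul0e.
Qed.

Lemma rho_null : leb2 (Omega `&` [set x | rho x = 0]) = 0%E.
Proof.
apply/negligibleP.
  by have := measurable_rho mOmega (measurable_set1 (0 : R)).
(* A zero of [rho] is a point of [D]; [insub] turns the union over ['I_l] into one over all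
   naturals. *)
have sub : Omega `&` [set x | rho x = 0] `<=` \bigcup_(n : nat)
    (if insub n is Some i then [set D i] else set0).
  move=> x [_ /=]; rewrite /Defs.rho; case: pickP => [i _|_ /eqP]; last by rewrite oner_eq0.
  by move=> /powR_eq0_eq0/edist_eq0 ->; exists i => //; rewrite valK.
apply: negligibleS; first exact: sub.
apply: negligible_bigcup => n.
case: insubP => [i _ _|_]; last exact: negligible_set0.
apply/negligibleP; last exact: leb2_point.
exact: measurable_point.
Qed.

(** A root at the first coordinate of t gives q(x_1)^2 <= C^2 |x-t|^2 = C^2 |x-t|^(2-alpha)
    |x-t|^alpha, where the first power is bounded on [Omega]. The estimate is proved on all of
    [Omega] for every index, so it holds whichever index [rho] picks. *)
Lemma poly_rho_le (q : {poly R}) : (forall i, root q (D i).1) ->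
  exists2 k, 0 <= k & forall x, Omega x -> q.[x.1] ^+ 2 <= k * rho x.
Proof.
move=> rq; have [L L0 OL] := bounded_sub_cbox Omega_bounded.
have [B B0 hB] := continuous_bounded_itv L (@continuous_horner _ q).
have xL x : Omega x -> `|x.1| <= L by move=> /OL [/=]; rewrite in_itv/= -ler_norml.
have sq (u v : R) : `|u| <= v -> u ^+ 2 <= v ^+ 2.
  by move=> uv; rewrite -[u ^+ 2]real_normK ?num_real// ler_pXn2r ?nnegrE// (le_trans _ uv).
have /choice [k hk] : forall i, exists k, 0 <= k /\ forall x, Omega x ->
    q.[x.1] ^+ 2 <= k * edist x (D i) `^ alpha.
  move=> i; have [r qr] := factor_theorem _ _ (rq i).
  have [C C0 hC] := continuous_bounded_itv L (@continuous_horner _ r).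
  have [E E0 hE] := edist_bounded (D i).
  exists (C ^+ 2 * E `^ (2 - alpha)); split.
    by apply: mulr_ge0; [exact: sqr_ge0|exact: powR_ge0].
  move=> x Ox; rewrite qr hornerM hornerXsubC exprMn -mulrA.
  apply: ler_pM; [exact: sqr_ge0|exact: sqr_ge0|exact/sq/hC/xL|].
  apply: le_trans (sq _ _ (edist_ge1 _ _)) _.
  have [->|e0] := eqVneq (edist x (D i)) 0.
    by rewrite expr0n mulr_ge0 ?powR_ge0.
  have -> : edist x (D i) ^+ 2 = edist x (D i) `^ (2 - alpha) * edist x (D i) `^ alpha.
    by rewrite -powRD ?e0 ?implybT// subrK powR_mulrn// edist_ge0.
  apply: ler_wpM2r; first exact: powR_ge0.
  have /andP[_ a2] := alpha02.
  apply: ge0_ler_powR; rewrite ?nnegrE ?edist_ge0 ?subr_ge0//; [exact: ltW|exact: ltW|exact: hE].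
have S0 (P : pred 'I_l) : 0 <= \sum_(i | P i) k i.
  by apply: sumr_ge0 => i _; have [] := hk i.
exists (\sum_i k i + B ^+ 2); first by rewrite addr_ge0 ?sqr_ge0.
move=> x Ox; rewrite /Defs.rho; case: pickP => [i _|_].
  apply: le_trans ((hk i).2 _ Ox) _; apply: ler_wpM2r; first exact: powR_ge0.
  by rewrite (bigD1 i)//= -addrA lerDl addr_ge0 ?sqr_ge0.
by rewrite mulr1; apply: le_trans (sq _ _ (hB _ (xL _ Ox))) _; rewrite lerDr.
Qed.

Lemma rho_embedding : exists2 C, 0 <= C & forall f, H10 Omega rho f ->
  (\int[leb2]_(x in Omega) (f x ^+ 2)%:E <= (C * H1norm2 Omega rho f)%:E)%E.
Proof.
have mr := measurable_rho; have r0 : forall x, Omega x -> 0 <= rho x by move=> x _; exact: rho_ge0.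
have [M rM] := rho_bounded.
(* Distinct points may share their first coordinate; duplicates are removed to keep the roots of [q]
   simple. *)
pose s := undup [seq (D i).1 | i : 'I_l].
pose q : {poly R} := \prod_(c <- s) ('X - c%:P).
have sq : coprimep q q^`().
  have : separable_poly (\prod_(c <- s) ('X - c%:P)) by rewrite separable_prod_XsubC undup_uniq.
  by rewrite separable_poly.unlock.
have rq i : root q (D i).1.
  by rewrite root_prod_XsubC mem_undup; apply/mapP; exists i => //; rewrite mem_enum.
have [k k0 qk] := poly_rho_le rq.
have [C C0 hC] := hardy_weighted Omega_open Omega_bounded mr r0 rM k0 qk sq.
exists (4 * C); first exact: mulr_ge0.
by move=> f Hf; apply: (H10_sqr_integrable Omega_open mr r0 rM C0 hC rho_null Hf).
Qed.

End Rho.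

(** * Differential calculus for products of vector-valued maps *)

Section Expansion.
Context {R : realType} (m n : nat).
Local Notation M := 'M[R]_(m, n).

(** Frechet differentiability with a prescribed derivative, in the epsilon form used by [C2].
    Linearity is a proposition, so that the derivative can be any explicit formula. *)
Definition has_diff (h : M -> R) (U : M) (dh : M -> R) :=
  (forall c V W, dh (c *: V + W) = c * dh V + dh W) /\
  forall e, 0 < e -> \forall U' \near U, `|h U' - h U - dh (U' - U)| <= e * `|U' - U|.

(** This is where finite dimension enters: continuity and boundedness of linear maps on matrices
    follow from this expansion. *)
Lemma lin_sum_delta (V : lmodType R) (dh : M -> V) :
  (forall c U W, dh (c *: U + W) = c *: dh U + dh W) ->
  forall H, dh H = \sum_i \sum_j H i j *: dh (delta_mx i j).
Proof.
move=> ldh H; have dh0 : dh 0 = 0.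
  by have := ldh (-1) 0 0; rewrite scaler0 addr0 scaleN1r addNr.
have dhD u v : dh (u + v) = dh u + dh v by have := ldh 1 u v; rewrite !scale1r.
have dhZ c u : dh (c *: u) = c *: dh u by have := ldh c u 0; rewrite dh0 !addr0.
rewrite {1}(matrix_sum_delta H) (big_morph dh dhD dh0); apply: eq_bigr => i _.
by rewrite (big_morph dh dhD dh0); apply: eq_bigr => j _; rewrite dhZ.
Qed.

(** As a finite combination of coordinates [dh] is continuous, so the epsilon estimate identifies it
    as the differential by uniqueness. *)
Lemma has_diffE h U dh : has_diff h U dh ->
  differentiable h U /\ ('d h U : M -> R) = dh.
Proof.
move=> [ldh edh].
have ldh' : linear (dh : M -> R^o) by move=> c u v; exact: ldh.
pose L := GRing.isLinear.Build _ _ _ _ (dh : M -> R^o) ldh'.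
pose dL : {linear M -> R^o} := HB.pack (dh : M -> R^o) L.
have cdh : continuous dh.
  have -> : dh = \sum_i \sum_j (fun H : M => H i j * dh (delta_mx i j)).
    apply/funext => H; rewrite (@lin_sum_delta R^o dh ldh) fct_sumE.
    by apply: eq_bigr => i _; rewrite fct_sumE.
  move=> H; apply: differentiable_continuous.
  apply: differentiable_sum => i; apply: differentiable_sum => j.
  by apply: differentiableM; [exact: differentiable_coord|exact: differentiable_cst].
have o : h \o shift U = cst (h U) + dL +o_ (0 : M) id.
  apply/eqaddoP => e e0.
  move: (edh _ e0); rewrite (near_shift 0) subr0; apply: filterS => H /=.
  rewrite /shift /= addrK => hH.
  rewrite -[X in `|X|]/(h (H + U) - (h U + dh H)) opprD addrA.
  exact: hH.
have E := @diff_unique R M R^o h dL U cdh o.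
split; last exact: E.
apply/diff_locallyP; rewrite E; split; first exact: cdh.
exact: o.
Qed.

Lemma has_diffD h1 h2 U d1 d2 : has_diff h1 U d1 -> has_diff h2 U d2 ->
  has_diff (fun X => h1 X + h2 X) U (fun W => d1 W + d2 W).
Proof.
move=> [l1 e1] [l2 e2]; split; first by move=> c V W; rewrite l1 l2; ring.
move=> e e0; have e20 : 0 < e / 2 by lra.
move: (e1 _ e20) (e2 _ e20); apply: filterS2 => U' H1 H2.
have -> : h1 U' + h2 U' - (h1 U + h2 U) - (d1 (U' - U) + d2 (U' - U)) =
  (h1 U' - h1 U - d1 (U' - U)) + (h2 U' - h2 U - d2 (U' - U)) by ring.
rewrite (le_trans (ler_normD _ _))// (splitr e) mulrDl; exact: lerD.
Qed.

Lemma has_diffZ c h U d : has_diff h U d ->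
  has_diff (fun X => c * h X) U (fun W => c * d W).
Proof.
move=> [l1 e1]; split; first by move=> a V W; rewrite l1; ring.
move=> e e0; have c0 : 0 < `|c| + 1 by rewrite ltr_wpDl.
move: (e1 _ (divr_gt0 e0 c0)); apply: filterS => U' H1.
rewrite -!mulrBr normrM (le_trans (ler_wpM2l (normr_ge0 c) H1))//.
rewrite mulrA ler_wpM2r// mulrCA ler_piMr ?(ltW e0)//.
by rewrite ler_pdivrMr// mul1r lerDl.
Qed.

Lemma has_diff_near h1 h2 U d : (\forall U' \near U, h1 U' = h2 U') ->
  has_diff h1 U d -> has_diff h2 U d.
Proof.
move=> E [l1 e1]; split => // e e0; have EU := nbhs_singleton E.
by move: E (e1 _ e0); apply: filterS2 => U' <-; rewrite EU.
Qed.

End Expansion.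

(** * Degenerate inner products and the product rule *)

Section InnerProduct.
Context {R : realType} (F : lmodType R) (X : set F) (ip : F -> F -> R).
Hypothesis mem0 : X 0.
Hypothesis mem_lin : forall c u v, X u -> X v -> X (c *: u + v).
Hypothesis ipC : forall u v, X u -> X v -> ip u v = ip v u.
Hypothesis ip_lin : forall c u v w, X u -> X v -> X w ->
  ip (c *: u + v) w = c * ip u w + ip v w.
Hypothesis ip_ge0 : forall u, X u -> 0 <= ip u u.

(** The form may be degenerate, with functions vanishing almost everywhere as null elements. Its
    laws are assumed on [X] only, since square-integrable fields form a subset of all fields. *)
Definition seminorm u := Num.sqrt (ip u u).

Lemma memD u v : X u -> X v -> X (u + v).
Proof. by move=> Xu Xv; have := mem_lin 1 Xu Xv; rewrite scale1r. Qed.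

Lemma memZ c u : X u -> X (c *: u).
Proof. by move=> Xu; have := mem_lin c Xu mem0; rewrite addr0. Qed.

Lemma memB u v : X u -> X v -> X (u - v).
Proof. by move=> Xu Xv; have := mem_lin (-1) Xv Xu; rewrite scaleN1r addrC. Qed.

Lemma ipD u v w : X u -> X v -> X w -> ip (u + v) w = ip u w + ip v w.
Proof. by move=> Xu Xv Xw; have := ip_lin 1 Xu Xv Xw; rewrite scale1r mul1r. Qed.

Lemma ip0 w : X w -> ip 0 w = 0.
Proof.
by move=> Xw; have := ip_lin (-1) mem0 mem0 Xw; rewrite scaler0 addr0 mulN1r addNr.
Qed.

Lemma ipZ c u w : X u -> X w -> ip (c *: u) w = c * ip u w.
Proof. by move=> Xu Xw; have := ip_lin c Xu mem0 Xw; rewrite addr0 ip0// addr0. Qed.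

Lemma ipDr u v w : X u -> X v -> X w -> ip w (u + v) = ip w u + ip w v.
Proof.
by move=> Xu Xv Xw; rewrite ipC ?ipD ?(ipC Xu) ?(ipC Xv)//; exact: memD.
Qed.

Lemma ipZr c u w : X u -> X w -> ip w (c *: u) = c * ip w u.
Proof. by move=> Xu Xw; rewrite ipC ?ipZ ?(ipC Xu)//; exact: memZ. Qed.

Lemma cauchy_schwarz u v : X u -> X v -> `|ip u v| <= seminorm u * seminorm v.
Proof.
move=> Xu Xv; rewrite -sqrtrM ?ip_ge0// -sqrtr_sqr ler_wsqrtr//.
set a := ip u u; set b := ip u v; set c := ip v v.
have H t : 0 <= t ^+ 2 * a + 2 * t * b + c.
  have := ip_ge0 (mem_lin t Xu Xv).
  rewrite ip_lin//; last exact: mem_lin.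
  rewrite !ipDr ?ipZr//; [|exact: memZ|exact: memZ].
  rewrite (ipC Xv Xu) -/a -/b -/c; congr (0 <= _); ring.
have a0 : 0 <= a by exact: ip_ge0.
have [a1|a1] := eqVneq a 0.
  suff -> : b = 0 by rewrite expr0n a1 mul0r.
  apply/eqP; apply/negPn/negP => b0.
  (* When the leading coefficient vanishes, this value of t makes the polynomial equal to -1. *)
  have := H (- (c + 1) / (2 * b)); rewrite a1 mulr0 add0r.
  have -> : 2 * (- (c + 1) / (2 * b)) * b = - (c + 1) by field.
  lra.
(* The minimum of the quadratic polynomial. *)
have := H (- b / a).
have -> : (- b / a) ^+ 2 * a + 2 * (- b / a) * b + c = (a * c - b ^+ 2) / a by field.
by rewrite pmulr_lge0 ?invr_gt0 ?subr_ge0// lt_neqAle eq_sym a1.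
Qed.

Lemma seminorm_ge0 u : 0 <= seminorm u.
Proof. exact: sqrtr_ge0. Qed.

Lemma seminormD u v : X u -> X v -> seminorm (u + v) <= seminorm u + seminorm v.
Proof.
move=> Xu Xv; rewrite -[leRHS]ger0_norm ?addr_ge0 ?seminorm_ge0// -sqrtr_sqr ler_wsqrtr//.
rewrite ipD ?ipDr//; [|exact: memD|..] => //.
have nu : seminorm u ^+ 2 = ip u u by rewrite sqr_sqrtr ?ip_ge0.
have nv : seminorm v ^+ 2 = ip v v by rewrite sqr_sqrtr ?ip_ge0.
have := le_trans (ler_norm _) (cauchy_schwarz Xu Xv).
rewrite (ipC Xv Xu) sqrrD nu nv; lra.
Qed.

Lemma seminormZ c u : X u -> seminorm (c *: u) = `|c| * seminorm u.
Proof.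
move=> Xu; rewrite /seminorm ipZ ?ipZr//; last exact: memZ.
by rewrite mulrA -expr2 sqrtrM ?sqr_ge0// sqrtr_sqr.
Qed.

Lemma seminorm0 : seminorm 0 = 0.
Proof. by rewrite /seminorm ip0// sqrtr0. Qed.

Lemma seminorm_sum (I : finType) (f : I -> F) : (forall i, X (f i)) ->
  X (\sum_i f i) /\ seminorm (\sum_i f i) <= \sum_i seminorm (f i).
Proof.
move=> Xf; elim/big_ind2 : _ => //; first by rewrite seminorm0.
  move=> u a v b [Xu au] [Xv bv]; split; first exact: memD.
  exact: le_trans (seminormD Xu Xv) (lerD au bv).
Qed.

Variables m n : nat.
Local Notation M := 'M[R]_(m, n).

(** Analogue of [has_diff] for the seminorm. Membership of [p] in [X] is asked only near [U], as the
    state map is controlled only on an open set. *)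
Definition has_diffX (p : M -> F) (U : M) (p1 : M -> F) :=
  [/\ \forall U' \near U, X (p U'),
      forall c V W, p1 (c *: V + W) = c *: p1 V + p1 W,
      forall W, X (p1 W) &
      forall e, 0 < e -> \forall U' \near U,
        seminorm (p U' - p U - p1 (U' - U)) <= e * `|U' - U|].

Lemma seminorm_lin_le (p1 : M -> F) : (forall c V W, p1 (c *: V + W) = c *: p1 V + p1 W) ->
  (forall W, X (p1 W)) -> exists2 K, 0 <= K & forall H, seminorm (p1 H) <= K * `|H|.
Proof.
move=> lp Xp; exists (\sum_i \sum_j seminorm (p1 (delta_mx i j))).
  by apply: sumr_ge0 => i _; apply: sumr_ge0 => j _; exact: seminorm_ge0.
move=> H; rewrite (lin_sum_delta lp).
have XH i j : X (H i j *: p1 (delta_mx i j)) by exact: memZ.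
have XS i : X (\sum_j H i j *: p1 (delta_mx i j)) by have [] := seminorm_sum (XH i).
apply: le_trans (seminorm_sum XS).2 _; rewrite mulr_suml; apply: ler_sum => i _.
apply: le_trans (seminorm_sum (XH i)).2 _; rewrite mulr_suml; apply: ler_sum => j _.
rewrite seminormZ// mulrC ler_wpM2l ?seminorm_ge0//.
rewrite [leRHS]/Num.norm /= mx_normrE.
by apply/bigmax_geP; right => /=; exists (i, j).
Qed.

(** With remainders r and s of the two maps, the error is ip r (q U) + ip (p U) s plus a term
    quadratic in the increment, each bounded by Cauchy-Schwarz. *)
Lemma has_diff_ip p U p1 q q1 : has_diffX p U p1 -> has_diffX q U q1 ->
  has_diff (fun Y => ip (p Y) (q Y)) U (fun W => ip (p1 W) (q U) + ip (p U) (q1 W)).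
Proof.
move=> [Xp lp Xp1 ep] [Xq lq Xq1 eq].
have XpU := nbhs_singleton Xp; have XqU := nbhs_singleton Xq.
have [K K0 hK] := seminorm_lin_le lp Xp1; have [L L0 hL] := seminorm_lin_le lq Xq1.
split.
  move=> c V W; rewrite lp lq ip_lin// ipDr ?ipZr//; [ring|exact: memZ].
move=> e e0.
(* The bound 1 gives the increments Lipschitz constants K+1 and L+1 independent of e. The other
   bound gives half of e to the two remainder terms; the quadratic term uses the other half. *)
pose d := Num.min 1 (e / 2 / (seminorm (p U) + seminorm (q U) + 1)).
have D0 : 0 < seminorm (p U) + seminorm (q U) + 1 by rewrite ltr_wpDl// addr_ge0 ?seminorm_ge0.
have d0 : 0 < d by rewrite lt_min ltr01 !divr_gt0.
have G0 : 0 < (K + 1) * (L + 1) by apply: mulr_gt0; lra.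
have hN c : 0 < c -> \forall U' \near U, `|U' - U| <= c.
  move=> c0; have /cvgrPdist_le/(_ _ c0) := @cvg_id _ (nbhs U).
  by apply: filterS => Y; rewrite distrC.
near=> U'.
have HG : `|U' - U| * ((K + 1) * (L + 1)) <= e / 2.
  rewrite -ler_pdivlMr//; near: U'; apply: hN.
  by rewrite !divr_gt0.
have Xp' : X (p U') by near: U'.
have Xq' : X (q U') by near: U'.
have hp : seminorm (p U' - p U - p1 (U' - U)) <= d * `|U' - U| by near: U'; exact: ep.
have hq : seminorm (q U' - q U - q1 (U' - U)) <= d * `|U' - U| by near: U'; exact: eq.
set H := U' - U in HG hp hq *.
set r := p U' - p U - p1 H in hp; set s := q U' - q U - q1 H in hq.
have Xr : X r by apply: memB => //; exact: memB.
have Xs : X s by apply: memB => //; exact: memB.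
have pE : p U' = p U + (p1 H + r) by rewrite /r [p1 H + _]addrC subrK addrC subrK.
have qE : q U' = q U + (q1 H + s) by rewrite /s [q1 H + _]addrC subrK addrC subrK.
have Xa := memD (Xp1 H) Xr; have Xb := memD (Xq1 H) Xs.
have -> : ip (p U') (q U') - ip (p U) (q U) - (ip (p1 H) (q U) + ip (p U) (q1 H)) =
    ip r (q U) + ip (p U) s + ip (p1 H + r) (q1 H + s).
  rewrite {1}pE {1}qE ipD//; last exact: memD.
  rewrite (ipDr XqU Xb XpU) (ipDr XqU Xb Xa) (ipDr (Xq1 H) Xs XpU).
  by rewrite (ipD (Xp1 H) Xr XqU); ring.
have H0 : 0 <= `|H| by [].
have d1 : d <= 1 by rewrite ge_min lexx.
have hd : d * (seminorm (p U) + seminorm (q U) + 1) <= e / 2.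
  by rewrite -ler_pdivlMr// ge_min lexx orbT.
have ha : seminorm (p1 H + r) <= (K + 1) * `|H|.
  apply: le_trans (seminormD (Xp1 H) Xr) _; rewrite mulrDl; apply: lerD => //.
  by apply: le_trans hp _; rewrite ler_wpM2r.
have hb : seminorm (q1 H + s) <= (L + 1) * `|H|.
  apply: le_trans (seminormD (Xq1 H) Xs) _; rewrite mulrDl; apply: lerD => //.
  by apply: le_trans hq _; rewrite ler_wpM2r.
have t1 : `|ip r (q U)| <= d * `|H| * seminorm (q U).
  by apply: le_trans (cauchy_schwarz Xr XqU) _; rewrite ler_wpM2r ?seminorm_ge0.
have t2 : `|ip (p U) s| <= seminorm (p U) * (d * `|H|).
  by apply: le_trans (cauchy_schwarz XpU Xs) _; rewrite ler_wpM2l ?seminorm_ge0.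
have t3 : `|ip (p1 H + r) (q1 H + s)| <= (K + 1) * `|H| * ((L + 1) * `|H|).
  apply: le_trans (cauchy_schwarz Xa Xb) _.
  by apply: ler_pM => //; exact: seminorm_ge0.
apply: le_trans (ler_normD _ _) _; apply: le_trans (lerD (ler_normD _ _) (lexx _)) _.
apply: le_trans (lerD (lerD t1 t2) t3) _.
have -> : d * `|H| * seminorm (q U) + seminorm (p U) * (d * `|H|) +
    (K + 1) * `|H| * ((L + 1) * `|H|) =
  (d * (seminorm (p U) + seminorm (q U)) + `|H| * ((K + 1) * (L + 1))) * `|H| by ring.
rewrite ler_wpM2r// (splitr e); apply: lerD => //.
by apply: le_trans hd; apply: ler_wpM2l; [exact: ltW|rewrite lerDl].
Unshelve. all: by end_near. Qed.

End InnerProduct.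

(** * Quadratic forms and square-integrable fields *)

Section FiniteDim.
Context {R : realType}.

Lemma bilinear_continuous (m n : nat) (b : 'M[R]_(m, n) -> 'M[R]_(m, n) -> R) :
  (forall W c U V, b (c *: U + V) W = c * b U W + b V W) ->
  (forall W c U V, b W (c *: U + V) = c * b W U + b W V) ->
  continuous (fun V => b V V).
Proof.
move=> bl br.
have -> : (fun V => b V V) = \sum_i \sum_j \sum_k \sum_h
   (fun V : 'M[R]_(m, n) => V i j * V k h * b (delta_mx i j) (delta_mx k h)).
  apply/funext => V; rewrite fct_sumE.
  rewrite (@lin_sum_delta R m n R^o (fun U => b U V) (bl V) V).
  apply: eq_bigr => i _; rewrite fct_sumE; apply: eq_bigr => j _.
  rewrite (@lin_sum_delta R m n R^o (b (delta_mx i j)) (br _) V) scaler_sumr fct_sumE.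
  apply: eq_bigr => k _; rewrite scaler_sumr fct_sumE; apply: eq_bigr => h _.
  by rewrite scalerA.
move=> V; apply: differentiable_continuous.
do 4!(apply: differentiable_sum => ?).
apply: differentiableM; last exact: differentiable_cst.
by apply: differentiableM; exact: differentiable_coord.
Qed.

Lemma coercive_on_closed_cone (n : nat) (K : set 'rV[R]_n) (q : 'rV[R]_n -> R) :
  closed K -> (forall c V, 0 < c -> K V -> K (c *: V)) ->
  continuous q -> (forall c V, q (c *: V) = c ^+ 2 * q V) ->
  (forall V, K V -> V != 0 -> 0 < q V) ->
  exists2 k, 0 < k & forall V, K V -> k * `|V| ^+ 2 <= q V.
Proof.
move=> cK sK cq hq pq.
pose S := K `&` [set V : 'rV[R]_n | `|V| = 1].
have cS : compact S.
  apply: bounded_closed_compact.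
    by exists 1; split=> // x x1 V [_ /= ->]; exact: ltW.
  apply: closedI => //.
  apply: (@closed_comp _ _ (fun V : 'rV[R]_n => `|V|) [set 1]).
    by move=> V _; exact: norm_continuous.
  exact: closed_eq.
have q0 : q 0 = 0 by have := hq 0 0; rewrite scale0r expr0n mul0r.
have nS V : K V -> V != 0 -> S (`|V|^-1 *: V).
  move=> KV V0; have nV : 0 < `|V| by rewrite normr_gt0.
  split; first by apply: sK => //; rewrite invr_gt0.
  by rewrite /= normrZ normfV normr_id mulVf// gt_eqF.
(* If the cone does not meet the sphere, it contains no nonzero vector and any constant works. *)
have [S0|S0] := pselect (S !=set0); last first.
  exists 1 => // V KV; have [->|V0] := eqVneq V 0; first by rewrite normr0 expr0n q0 mulr0.
  by case: S0; exists (`|V|^-1 *: V); exact: nS.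
have [V0 SV0 minV0] := EVT_min_rV S0 cS (continuous_subspaceT cq).
exists (q V0).
  have [KV0 /= nV0] : S V0 by move: SV0; rewrite inE.
  apply: pq => //; apply/negP => /eqP V00; move: nV0; rewrite V00 normr0 => /eqP.
  by rewrite eq_sym oner_eq0.
move=> V KV; have [->|Vn0] := eqVneq V 0; first by rewrite normr0 expr0n q0 mulr0.
have nV : 0 < `|V| by rewrite normr_gt0.
have := minV0 _ (mem_set (nS _ KV Vn0)); rewrite hq => h.
have -> : q V = (`|V|^-1 ^+ 2 * q V) * `|V| ^+ 2.
  by rewrite mulrAC -exprMn mulVf ?gt_eqF// expr1n mul1r.
by apply: ler_wpM2r h; exact: sqr_ge0.
Qed.

Lemma uniform_lower_bound (I : finType) (f : I -> R) : (forall i, 0 < f i) ->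
  exists2 tau, 0 < tau & forall i, tau < f i.
Proof.
move=> f0; pose s := \big[Num.min/1]_i f i.
have s0 : 0 < s by apply: lt_bigmin.
exists (s / 2); first by rewrite divr_gt0.
move=> i; apply: (@lt_le_trans _ _ s); first by rewrite ltr_pdivrMr// ltr_pMr// ltr1n.
exact: bigmin_le.
Qed.

Lemma sum_ord2 (V : nmodType) (F : 'I_2 -> V) : \sum_i F i = F 0 + F 1.
Proof.
rewrite big_ord_recl big_ord1; congr (_ + F _); exact/val_inj.
Qed.

(** Written as an inner product so that the control cost and the tracking term are both
    differentiated by [has_diff_ip]. *)
Definition mdot (m : nat) (U V : 'M[R]_(m, 2)) : R := \sum_t dot (row t U) (row t V).

Lemma dotC (u v : 'rV[R]_2) : dot u v = dot v u.
Proof. by apply: eq_bigr => i _; rewrite mulrC. Qed.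

Lemma dot_lin (c : R) (u v w : 'rV[R]_2) : dot (c *: u + v) w = c * dot u w + dot v w.
Proof.
rewrite /dot mulr_sumr -big_split/=; apply: eq_bigr => i _.
by rewrite !mxE; ring.
Qed.

Lemma dot_ge0 (u : 'rV[R]_2) : 0 <= dot u u.
Proof. by apply: sumr_ge0 => i _; rewrite -expr2 sqr_ge0. Qed.

Lemma mdotC (m : nat) (U V : 'M[R]_(m, 2)) : mdot U V = mdot V U.
Proof. by apply: eq_bigr => i _; rewrite dotC. Qed.

Lemma mdot_lin (m : nat) (c : R) (U V W : 'M[R]_(m, 2)) :
  mdot (c *: U + V) W = c * mdot U W + mdot V W.
Proof.
rewrite /mdot mulr_sumr -big_split/=; apply: eq_bigr => t _.
by rewrite linearP /= dot_lin.
Qed.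

Lemma mdot_ge0 (m : nat) (U : 'M[R]_(m, 2)) : 0 <= mdot U U.
Proof. by apply: sumr_ge0 => i _; exact: dot_ge0. Qed.

Lemma mdotE (m : nat) (U V : 'M[R]_(m, 2)) : mdot U V = \sum_t \sum_i U t i * V t i.
Proof. by apply: eq_bigr => t _; apply: eq_bigr => i _; rewrite !mxE. Qed.

Lemma mdot_gt0 (m : nat) (U : 'M[R]_(m, 2)) : U != 0 -> 0 < mdot U U.
Proof.
move=> U0; rewrite lt_neqAle mdot_ge0 andbT eq_sym; apply: contra U0.
have p t i : 0 <= U t i * U t i by rewrite -expr2 sqr_ge0.
rewrite mdotE psumr_eq0; last by move=> t _; apply: sumr_ge0 => i _.
move=> /allP h; apply/eqP/matrixP => t i; rewrite mxE.
have := h t (mem_index_enum _); rewrite /= psumr_eq0 //.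
move=> /allP /(_ i (mem_index_enum _)) /=.
by rewrite mulf_eq0 orbb => /eqP.
Qed.

End FiniteDim.

(** * The unweighted inner product of square-integrable fields *)

Section L2Fields.
Context {R : realType}.
Local Notation T2 := (measurableTypeR R * measurableTypeR R)%type.
Implicit Types (u v w : R * R -> 'rV[R]_2) (f g h : R * R -> R).
Variable Omega : set (R * R).
Hypothesis Omega_open : open Omega.
Let mOmega : measurable (Omega : set T2) := open_measurable2 Omega_open.

Local Notation one := (fun=> 1 : R).
Let m1 : measurable_fun (Omega : set T2) (one : T2 -> R) := measurable_cst _.
Let one0 : forall x, Omega x -> 0 <= one x := fun _ _ => ler01.

Lemma vcomp_lin i (c : R) u v : vcomp i (c *: u + v) = c *: vcomp i u + vcomp i v.
Proof.
apply/funext => x; rewrite /vcomp -[(c *: u + v) x]/(c *: u x + v x) !mxE.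
by [].
Qed.

Lemma L2_one0 : L2 Omega one (fun=> 0).
Proof.
split; first exact: measurable_cst.
rewrite (_ : (fun x => _) = cst 0%E); first by rewrite integral0 ltry.
by apply/funext => x /=; rewrite expr0n mul0r.
Qed.

Lemma L2v0 : L2v Omega one 0.
Proof.
move=> i; rewrite (_ : vcomp i 0 = fun=> 0); first exact: L2_one0.
by apply/funext => x; rewrite /vcomp mxE.
Qed.

Lemma L2v_lin (c : R) u v : L2v Omega one u -> L2v Omega one v -> L2v Omega one (c *: u + v).
Proof.
by move=> Lu Lv i; rewrite vcomp_lin; apply: (L2_lin Omega_open m1 one0).
Qed.

Lemma L2_mul_integrable f g : L2 Omega one f -> L2 Omega one g ->
  leb2.-integrable (Omega : set T2) (EFin \o (fun x => f x * g x)).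
Proof.
move=> Lf Lg.
have i2 := integrable_lin 1 mOmega (L2_integrable m1 one0 Lf) (L2_integrable m1 one0 Lg).
apply: le_integrable i2 => //.
  by apply/measurable_EFinP; apply: measurable_funM; [exact: Lf.1|exact: Lg.1].
move=> x Ox; rewrite lee_fin (le_trans _ (ler_norm _))//.
rewrite -[leRHS]/(1 * (f x ^+ 2 * 1) + g x ^+ 2 * 1) mul1r !mulr1 normrM.
rewrite -(real_normK (num_real (f x))) -(real_normK (num_real (g x))).
have h0 := sqr_ge0 (`|f x| - `|g x|).
have h1 : 0 <= `|f x| * `|g x| by apply: mulr_ge0.
have h2 : (`|f x| - `|g x|) ^+ 2 = `|f x| ^+ 2 + `|g x| ^+ 2 - 2 * (`|f x| * `|g x|) by ring.
lra.
Qed.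

Definition ip u v : R := \int[leb2]_(x in Omega) dot (u x) (v x).

Lemma dot_integrable u v : L2v Omega one u -> L2v Omega one v ->
  leb2.-integrable (Omega : set T2) (EFin \o (fun x => dot (u x) (v x))).
Proof.
move=> Lu Lv.
have i2 := integrable_lin 1 mOmega (L2_mul_integrable (Lu 0) (Lv 0))
  (L2_mul_integrable (Lu 1) (Lv 1)).
apply: eq_integrable i2 => // x _; congr EFin.
rewrite -[LHS]/(1 * (u x 0 0 * v x 0 0) + u x 0 1 * v x 0 1) mul1r /dot.
by rewrite sum_ord2.
Qed.

Lemma ip_sym u v : ip u v = ip v u.
Proof. by apply: eq_Rintegral => x _; rewrite dotC. Qed.

Lemma ip_linl (c : R) u v w : L2v Omega one u -> L2v Omega one v -> L2v Omega one w ->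
  ip (c *: u + v) w = c * ip u w + ip v w.
Proof.
move=> Lu Lv Lw; rewrite /ip -Rintegral_lin//; [|exact: dot_integrable..].
by apply: eq_Rintegral => x _; rewrite -dot_lin.
Qed.

Lemma ip_pos u : 0 <= ip u u.
Proof. by apply: Rintegral_ge0 => x _; exact: dot_ge0. Qed.

Lemma ip_selfE u : L2v Omega one u ->
  ip u u = \int[leb2]_(x in Omega) (vcomp 0 u x ^+ 2) +
           \int[leb2]_(x in Omega) (vcomp 1 u x ^+ 2).
Proof.
move=> Lu.
have E i : \int[leb2]_(x in Omega) (vcomp i u x ^+ 2) =
    \int[leb2]_(x in Omega) (vcomp i u x * vcomp i u x).
  by apply: eq_Rintegral => x _; rewrite expr2.
rewrite !E -[X in X + _]mul1r -Rintegral_lin//; [|exact: L2_mul_integrable..].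
apply: eq_Rintegral => x _; by rewrite /dot sum_ord2 mul1r.
Qed.

Variables (rho : R * R -> R) (C : R).
Hypothesis C0 : 0 <= C.
Hypothesis rho0 : forall x, Omega x -> 0 <= rho x.
Hypothesis emb : forall f, H10 Omega rho f ->
  (\int[leb2]_(x in Omega) (f x ^+ 2)%:E <= (C * H1norm2 Omega rho f)%:E)%E.

Lemma H10v_L2v u : H10v Omega rho u -> L2v Omega one u.
Proof.
move=> Hu i; split; first exact: (Hu i).1.1.1.
under eq_integral do rewrite mulr1.
by apply: le_lt_trans (emb (Hu i)) _; rewrite ltry.
Qed.

Lemma seminorm_H1vnorm u : H10v Omega rho u -> seminorm ip u <= Num.sqrt C * H1vnorm Omega rho u.
Proof.
move=> Hu; have Lu := H10v_L2v Hu.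
rewrite /seminorm /H1vnorm -sqrtrM// ler_wsqrtr// ip_selfE// sum_ord2 mulrDr.
have E i : \int[leb2]_(x in Omega) (vcomp i u x ^+ 2) <= C * H1norm2 Omega rho (vcomp i u).
  have := emb (Hu i); rewrite /Rintegral => h; rewrite -lee_fin fineK//.
  rewrite ge0_fin_numE; first by apply: le_lt_trans h _; rewrite ltry.
  by apply: integral_ge0 => x _; rewrite lee_fin sqr_ge0.
by apply: lerD; exact: E.
Qed.

End L2Fields.

(** * The reduced cost and its second derivative *)

Section ReducedCost.
Context {R : realType}.
Local Notation T2 := (measurableTypeR R * measurableTypeR R)%type.
Local Notation fld := (R * R -> 'rV[R]_2).
Variables (Omega : set (R * R)) (l : nat) (D : 'I_l -> R * R).
Variables (alpha eta : R) (yO : fld).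
Hypothesis Omega_open : open Omega.
Hypothesis Omega_bounded : bounded_set Omega.
Hypothesis alpha02 : 0 < alpha < 2.
Hypothesis LyO : L2v Omega (fun=> 1) yO.
Local Notation M := 'M[R]_(l, 2).
Local Notation w := (rho Omega D alpha).
Local Notation X := (L2v Omega (fun=> 1)).
Local Notation ipO := (ip Omega).

Variables (OU : set M) (Qy : M -> fld).
Hypothesis OU_open : open OU.
Variables (f1 : M -> M -> fld) (f2 : M -> M -> M -> fld).
Hypothesis C2Q : forall U, OU U ->
  [/\ Vdiv Omega w (Qy U),
      linear (f1 U) /\ forall W, Vdiv Omega w (f1 U W),
      [/\ forall W, linear (f2 U W), forall W, linear (fun W' => f2 U W' W)
        & forall W W', Vdiv Omega w (f2 U W W')]
    & forall e, 0 < e -> \forall U' \near U,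
      [/\ H1vnorm Omega w (Qy U' - Qy U - f1 U (U' - U)) <= e * `|U' - U|,
          forall W, H1vnorm Omega w (f1 U' W - f1 U W - f2 U (U' - U) W)
                    <= e * `|U' - U| * `|W|
        & forall W W', H1vnorm Omega w (f2 U' W W' - f2 U W W') <= e * `|W| * `|W'| ]].

Lemma H10v_B (u v : fld) : H10v Omega w u -> H10v Omega w v -> H10v Omega w (u - v).
Proof.
have mr : measurable_fun (Omega : set T2) w by exact: measurable_rho.
have [B rB] := rho_bounded D Omega_bounded alpha02.
have r0 : forall x, Omega x -> 0 <= w x by move=> x _; exact: rho_ge0.
move=> Hu Hv i; have -> : vcomp i (u - v) = -1 *: vcomp i v + vcomp i u.
  by rewrite -vcomp_lin scaleN1r addrC.
exact: (H10_lin Omega_open mr r0 rB (-1) (Hv i) (Hu i)).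
Qed.

Lemma H10v_norm : exists2 c, 0 < c & forall u, H10v Omega w u ->
  X u /\ seminorm ipO u <= c * H1vnorm Omega w u.
Proof.
have [C C0 hC] := rho_embedding D Omega_open Omega_bounded alpha02.
(* Adding 1 makes the constant positive, so that tolerances can be divided by it. *)
exists (Num.sqrt C + 1); first by rewrite ltr_wpDl// sqrtr_ge0.
move=> u Hu; split; first exact: (H10v_L2v hC Hu).
apply: le_trans (seminorm_H1vnorm Omega_open C0 hC Hu) _.
by apply: ler_wpM2r; [exact: sqrtr_ge0|rewrite lerDl].
Qed.

Lemma near_OU U : OU U -> \forall U' \near U, OU U'.
Proof. by move=> OUU; exact: open_nbhs_nbhs. Qed.

Let mem_lin := @L2v_lin R Omega Omega_open.

(** The embedding turns the weighted Sobolev estimates of [C2] into estimates for the norm in which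
    the cost measures the state. *)
Lemma has_diffX_state U : OU U -> has_diffX X ipO (fun Y => Qy Y - yO) U (f1 U).
Proof.
move=> OUU; have [c c0 hc] := H10v_norm.
have [[HQ _] [l1 V1] _ est] := C2Q OUU.
split.
- apply: filterS (near_OU OUU) => Y OY; have [[HY _] _ _ _] := C2Q OY.
  by apply: (memB mem_lin) => //; exact: (hc _ HY).1.
- exact: l1.
- by move=> W; have [h _] := V1 W; exact: (hc _ h).1.
- move=> e e0; apply: filterS2 (near_OU OUU) (est _ (divr_gt0 e0 c0)) => Y OY [h _ _].
  have [[HY _] _ _ _] := C2Q OY; have [H1 _] := V1 (Y - U).
  have -> : Qy Y - yO - (Qy U - yO) - f1 U (Y - U) = Qy Y - Qy U - f1 U (Y - U).
    by congr (_ - _); rewrite opprB addrA subrK.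
  have [_ hn] := hc _ (H10v_B (H10v_B HY HQ) H1).
  apply: le_trans hn _; rewrite mulrC -ler_pdivlMr//; apply: le_trans h _.
  by rewrite mulrAC.
Qed.

(** In [f2 U W V] the increment of the base point comes first and the direction of the first
    derivative second. *)
Lemma has_diffX_sensitivity U V : OU U ->
  has_diffX X ipO (fun Y => f1 Y V) U (fun W => f2 U W V).
Proof.
move=> OUU; have [c c0 hc] := H10v_norm.
have [_ [l1 V1] [l2 l2' V2] est] := C2Q OUU.
split.
- apply: filterS (near_OU OUU) => Y OY; have [_ [_ VY] _ _] := C2Q OY.
  by have [h _] := VY V; exact: (hc _ h).1.
- by move=> a W W'; exact: l2'.
- by move=> W; have [h _] := V2 W V; exact: (hc _ h).1.
- move=> e e0; have n0 : 0 < `|V| + 1 by rewrite ltr_wpDl.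
  have cn0 : 0 < c * (`|V| + 1) by exact: mulr_gt0.
  apply: filterS2 (near_OU OUU) (est _ (divr_gt0 e0 cn0)) => Y OY [_ h _].
  have [_ [_ VY] _ _] := C2Q OY.
  have [_ hn] := hc _ (H10v_B (H10v_B (VY V).1 (V1 V).1) (V2 (Y - U) V).1).
  apply: le_trans hn _; apply: le_trans (ler_wpM2l (ltW c0) (h V)) _.
  have -> : c * (e / (c * (`|V| + 1)) * `|Y - U| * `|V|) =
      e * `|Y - U| * (`|V| / (`|V| + 1)).
    by field; rewrite ?gt_eqF.
  rewrite ler_piMr//; first by apply: mulr_ge0 => //; exact: ltW.
  by rewrite ler_pdivrMr// mul1r lerDl.
Qed.

Lemma near_matrix (U : M) (P : set M) : (forall Y, P Y) -> \forall Y \near U, P Y.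
Proof. by move=> h; apply: (@filterS _ (nbhs U) _ setT) => //; exact: filterT. Qed.

Lemma has_diffX_cst (F : lmodType R) (S : set F) (b : F -> F -> R) (v : F) (U : M) :
  S 0 -> S v -> (forall c u v w, S u -> S v -> S w -> b (c *: u + v) w = c * b u w + b v w) ->
  has_diffX S b (fun=> v) U (fun=> 0).
Proof.
move=> S0 Sv bl; split => //.
- exact: near_matrix.
- by move=> c V W; rewrite scaler0 addr0.
- move=> e e0; apply: near_matrix => Y; rewrite subrr subr0 (seminorm0 S0 bl).
  by apply: mulr_ge0 => //; exact: ltW.
Qed.

Lemma has_diffX_id (U : M) : has_diffX setT (@mdot R l) id U id.
Proof.
split; [|by []|by []|].
  exact: near_matrix.
move=> e e0; apply: near_matrix => Y; rewrite subrr (@seminorm0 R M setT)//.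
  by apply: mulr_ge0 => //; exact: ltW.
by move=> c u v x _ _ _; exact: mdot_lin.
Qed.

Let ip_diff p U p1 q q1 := @has_diff_ip R _ X ipO (L2v0 Omega) mem_lin
  (fun u v _ _ => ip_sym Omega u v) (@ip_linl R Omega Omega_open)
  (fun u _ => ip_pos Omega u) l 2 p U p1 q q1.

Let mdot_diff p U p1 q q1 := @has_diff_ip R M setT (@mdot R l) I (fun _ _ _ _ _ => I)
  (fun u v _ _ => mdotC u v) (fun c u v x _ _ _ => mdot_lin c u v x)
  (fun u _ => mdot_ge0 u) l 2 p U p1 q q1.

Local Notation j := (reduced_cost Omega eta yO Qy).
Local Notation g := (fun Y => Qy Y - yO).

(** Left unsimplified, exactly as the product rule produces it, so that the rules compose without
    rewriting. The same holds for [hessian], where the terms with [mdot] of 0 come from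
    differentiating the constant direction [V]. *)
Definition first_derivative (U V : M) : R :=
  2^-1 * (ipO (f1 U V) (g U) + ipO (g U) (f1 U V)) +
  eta / 2 * (mdot V U + mdot U V).

Lemma has_diff_reduced_cost U : OU U -> has_diff j U (first_derivative U).
Proof.
move=> OUU; have h1 := has_diffX_state OUU; have h2 := has_diffX_id U.
exact: (has_diffD (has_diffZ 2^-1 (ip_diff h1 h1)) (has_diffZ (eta / 2) (mdot_diff h2 h2))).
Qed.

Definition hessian (U V W : M) : R :=
  2^-1 * ((ipO (f2 U W V) (g U) + ipO (f1 U V) (f1 U W)) +
          (ipO (f1 U W) (f1 U V) + ipO (g U) (f2 U W V))) +
  eta / 2 * ((mdot 0 U + mdot V W) + (mdot W V + mdot U 0)).

Lemma has_diff_first_derivative U V : OU U ->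
  has_diff (fun Y => first_derivative Y V) U (hessian U V).
Proof.
move=> OUU; have h1 := has_diffX_state OUU; have h2 := has_diffX_id U.
have h3 := has_diffX_sensitivity V OUU.
have h4 : has_diffX setT (@mdot R l) (fun=> V) U (fun=> 0).
  by apply: has_diffX_cst => // c u v x _ _ _; exact: mdot_lin.
exact: (has_diffD
  (has_diffZ 2^-1 (has_diffD (ip_diff h3 h1) (ip_diff h1 h3)))
  (has_diffZ (eta / 2) (has_diffD (mdot_diff h4 h2) (mdot_diff h2 h4)))).
Qed.

(** The first differential is itself differentiated in its base point, so its formula is needed on a
    whole neighbourhood, which openness of [OU] provides. *)
Lemma second_derivativeE U V W : OU U -> second_derivative j U V W = hessian U V W.
Proof.
move=> OUU; rewrite /second_derivative.
have : has_diff (fun Y => ('d j Y : M -> R) V) U (hessian U V).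
  apply: has_diff_near (has_diff_first_derivative V OUU).
  apply: filterS (near_OU OUU) => Y OY.
  by have [_ ->] := has_diffE (has_diff_reduced_cost OY).
by move=> /has_diffE [_ ->].
Qed.

Lemma hessian_linr U V c W W' : OU U ->
  hessian U V (c *: W + W') = c * hessian U V W + hessian U V W'.
Proof. by move=> OUU; have [h _] := has_diff_first_derivative V OUU; exact: h. Qed.

(** In the increment, linearity is part of being a differential. In this argument it comes from the
    linearity of [f1 U] and [f2 U W]. *)
Lemma hessian_linl U W c V V' : OU U ->
  hessian U (c *: V + V') W = c * hessian U V W + hessian U V' W.
Proof.
move=> OUU; have [k k0 hk] := H10v_norm.
have [[HQ _] [l1 V1] [l2 l2' V2] _] := C2Q OUU.
have X1 Y : X (f1 U Y) by exact: (hk _ (V1 Y).1).1.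
have X2 Y Z : X (f2 U Y Z) by exact: (hk _ (V2 Y Z).1).1.
have Xg : X (g U) by apply: (memB mem_lin) => //; exact: (hk _ HQ).1.
have ipr a u v x : X u -> X v -> X x -> ipO x (a *: u + v) = a * ipO x u + ipO x v.
  by move=> Xu Xv Xx; rewrite ![ipO x _]ip_sym ip_linl.
have mdr a (u v x : M) : mdot x (a *: u + v) = a * mdot x u + mdot x v.
  by rewrite ![mdot x _]mdotC mdot_lin.
have m0l (u : M) : mdot 0 u = 0.
  by have := mdot_lin (-1) 0 0 u; rewrite scaler0 addr0 mulN1r addNr.
rewrite /hessian l1 l2 !ip_linl ?ipr// !mdot_lin !mdr ![mdot U 0]mdotC !m0l.
ring.
Qed.

End ReducedCost.

(** * Closedness and scaling of the critical cone *)

Section Cone.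
Context {R : realType} (l : nat).
Variables (D : 'I_l -> R * R) (eta : R) (z : R * R -> 'rV[R]_2).
Variables (a b U : 'M[R]_(l, 2)).

(** Vectorised because the coercivity lemma is about row vectors. Each condition is an implication
    whose premise does not involve the vector, hence either void or a closed condition on one
    coordinate. *)
Lemma closed_vec_mx_cone : closed [set v : 'rV[R]_(l * 2) | cone D eta z a b U (vec_mx v)].
Proof.
pose A (P : Prop) (S : set R) (t : 'I_l) (i : 'I_2) :=
  [set v : 'rV[R]_(l * 2) | P -> S (v 0 (mxvec_index t i))].
have cA P S t i : closed S -> closed (A P S t i).
  move=> cS; have [p|np] := pselect P; last first.
    rewrite (_ : A P S t i = setT); first exact: closedT.
    by apply/seteqP; split => // v _ /np.
  rewrite (_ : A P S t i = (fun v : 'rV[R]_(l * 2) => v 0 (mxvec_index t i)) @^-1` S).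
    by apply: closed_comp => // v _; exact: coord_continuous.
  by apply/seteqP; split => v; [exact|move=> h _].
rewrite (_ : [set v | _] = \bigcap_t \bigcap_i
  (A (U t i = a t i) [set x | 0 <= x] t i `&` A (U t i = b t i) [set x | x <= 0] t i `&`
   A (Psi D eta z U t 0 i <> 0) [set 0] t i)).
  apply: closed_bigI => t _; apply: closed_bigI => i _.
  apply: closedI; first apply: closedI; apply: cA.
  - exact: closed_ge.
  - exact: closed_le.
  - exact: closed_eq.
have E (v : 'rV[R]_(l * 2)) t i : vec_mx v t i = v 0 (mxvec_index t i) by rewrite mxE.
apply/seteqP; split => [v [s c] t _ i _|v h].
  split; first split; rewrite /A /= -E => p.
  - exact: (s t i).1.
  - exact: (s t i).2.
  - exact: c.
split => [t i|t i p]; rewrite E.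
  by have [[h1 h2] _] := h t Logic.I i Logic.I; split; [exact: h1|exact: h2].
by have [_ h3] := h t Logic.I i Logic.I; exact: h3.
Qed.

Lemma coneZ (c : R) V : 0 < c -> cone D eta z a b U V -> cone D eta z a b U (c *: V).
Proof.
move=> c0 [s h]; split => [t i|t i p]; rewrite mxE.
  by rewrite pmulr_rge0// pmulr_rle0//; exact: s.
by rewrite h// mulr0.
Qed.

(** The norm of row vectors is the max norm; the double sum of ones is the number 2l of entries. *)
Lemma mdot_mxvec_le (V : 'M[R]_(l, 2)) :
  mdot V V <= (\sum_(t < l) \sum_(i < 2) 1) * `|mxvec V| ^+ 2.
Proof.
rewrite mdotE mulr_suml; apply: ler_sum => t _; rewrite mulr_suml; apply: ler_sum => i _.
rewrite mul1r -expr2 -[leLHS]real_normK ?num_real// ler_pXn2r ?nnegrE//.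
rewrite -(mxvecE V t i) [leRHS]/Num.norm /= mx_normrE.
by apply/bigmax_geP; right => /=; exists (0, mxvec_index t i).
Qed.

End Cone.

(** * Positivity against coercivity of the second derivative *)

Lemma bilinear_homogeneous (R : realType) (m n : nat)
    (b : 'M[R]_(m, n) -> 'M[R]_(m, n) -> R) :
  (forall W c U V, b (c *: U + V) W = c * b U W + b V W) ->
  (forall W c U V, b W (c *: U + V) = c * b W U + b W V) ->
  forall c V, b (c *: V) (c *: V) = c ^+ 2 * b V V.
Proof.
move=> bl br c V.
have b0 W : b 0 W = 0 by have := bl W (-1) 0 0; rewrite scaler0 addr0 mulN1r addNr.
have b0' W : b W 0 = 0 by have := br W (-1) 0 0; rewrite scaler0 addr0 mulN1r addNr.
have := bl (c *: V) c V 0; rewrite addr0 b0 addr0 => ->.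
by have := br V c V 0; rewrite addr0 b0' addr0 => ->; rewrite mulrA expr2.
Qed.

Theorem theorem6p5 (R : realType) (Omega : set (R * R)) (l : nat)
    (D : 'I_l -> R * R) (nu eta alpha : R) (yO : R * R -> 'rV[R]_2)
    (a b : 'M[R]_(l, 2))
    (hOmega_open : open Omega) (hOmega_conn : connected Omega)
    (hOmega_bnd : bounded_set Omega) (hOmega_lip : lipschitz_boundary Omega)
    (hl : (0 < l)%N) (hD_inj : injective D) (hD : forall t, Omega (D t))
    (hnu : 0 < nu) (heta : 0 < eta) (hyO : L2v Omega (fun=> 1) yO)
    (halpha : 0 < alpha < 2) (hab : forall t i, a t i < b t i)
    (Ubar : 'M[R]_(l, 2)) (ybar : R * R -> 'rV[R]_2) (pbar : R * R -> R)
    (zbar : R * R -> 'rV[R]_2) (rbar : R * R -> R)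
    (hUbar : Uad a b Ubar)
    (hstate : weak_solution Omega D nu alpha Ubar ybar pbar)
    (hadjoint : adjoint_solution Omega D nu alpha yO ybar zbar rbar)
    (hzbar : {within closure Omega, continuous zbar})
    (hvar : forall U, Uad a b U ->
      0 <= \sum_t dot (zbar (D t) + eta *: row t Ubar) (row t U - row t Ubar))
    (hreg : regular Omega nu ybar)
    (OU : set 'M[R]_(l, 2)) (Oy : set (R * R -> 'rV[R]_2))
    (Op : set (R * R -> R))
    (Qy : 'M[R]_(l, 2) -> R * R -> 'rV[R]_2)
    (Qp : 'M[R]_(l, 2) -> R * R -> R)
    (hQ : local_solution_map Omega D nu alpha Ubar ybar pbar OU Oy Op Qy Qp) :
  (forall V, cone D eta zbar a b Ubar V -> V != 0 ->
     0 < second_derivative (reduced_cost Omega eta yO Qy) Ubar V V)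
  <->
  (exists kappa tau : R, [/\ 0 < kappa, 0 < tau &
     forall V, cone_tau D tau eta zbar a b Ubar V ->
       kappa * (\sum_t dot (row t V) (row t V))
         <= second_derivative (reduced_cost Omega eta yO Qy) Ubar V V]).
Proof.
have [[OUo _ _] [OUU _ _] [[f1 [f2 C2Q]] _] _ _] := hQ.
pose q V := hessian Omega eta yO Qy f1 f2 Ubar V V.
have secE V : second_derivative (reduced_cost Omega eta yO Qy) Ubar V V = q V.
  exact: (second_derivativeE eta hOmega_open hOmega_bnd halpha hyO OUo C2Q V V OUU).
have bl W c V V' := hessian_linl eta hOmega_open hOmega_bnd halpha hyO C2Q W c V V' OUU.
have br V c W W' := hessian_linr eta hOmega_open hOmega_bnd halpha hyO OUo C2Q V c W W' OUU.
split; last first.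
  (* Since tau > 0, an entry of Psi exceeding tau in modulus is nonzero, so [cone] is contained in
     [cone_tau]. *)
  move=> [kappa [tau [k0 t0 h]]] V [sV cV] V0.
  have := mdot_gt0 V0; rewrite -(pmulr_rgt0 _ k0) => /lt_le_trans; apply; apply: h.
  split => // t i ti; apply: cV => P0; move: ti.
  by rewrite P0 normr0 ltNge ltW.
move=> pos.
(* tau is taken below every nonzero modulus of an entry of Psi; zero entries are replaced by 1 to
   keep the family positive. *)
have [|tau t0 ht] := @uniform_lower_bound R ('I_l * 'I_2)%type
  (fun k => if Psi D eta zbar Ubar k.1 0 k.2 == 0 then 1
            else `|Psi D eta zbar Ubar k.1 0 k.2|).
  by move=> k; case: ifPn => //; rewrite normr_gt0.
have tau_cone V : cone_tau D tau eta zbar a b Ubar V -> cone D eta zbar a b Ubar V.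
  move=> [sV cV]; split => // t i /eqP P0; apply: cV.
  by have := ht (t, i); rewrite /= (negbTE P0).
pose B (v w : 'rV[R]_(l * 2)) :=
  hessian Omega eta yO Qy f1 f2 Ubar (vec_mx v) (vec_mx w).
have Bl w c u v : B (c *: u + v) w = c * B u w + B v w by rewrite /B linearP bl.
have Br w c u v : B w (c *: u + v) = c * B w u + B w v by rewrite /B linearP br.
have [||k k0 hk] := coercive_on_closed_cone (@closed_vec_mx_cone R l D eta zbar a b Ubar) _
    (bilinear_continuous Bl Br) (bilinear_homogeneous Bl Br).
- by move=> c v c0 /= Kv; rewrite linearZ; exact: coneZ.
- move=> v Kv v0; rewrite /B -/(q (vec_mx v)) -secE; apply: pos => //.
  by apply: contra v0 => /eqP v0; rewrite -(vec_mxK v) v0 linear0.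
pose N : R := \sum_(t < l) \sum_(i < 2) 1.
have N0 : 0 <= N by apply: sumr_ge0 => t _; apply: sumr_ge0.
have N1 : 0 < N + 1 by rewrite ltr_wpDl.
(* [k] is coercive for the max norm; [N] converts to the Euclidean norm, and adding 1 keeps the
   divisor positive. *)
exists (k / (N + 1)), tau; split => //; first by rewrite divr_gt0.
move=> V /tau_cone cV; rewrite secE -[V in q V]mxvecK -/(B (mxvec V) (mxvec V)).
apply: le_trans (hk (mxvec V) _); last by rewrite /= mxvecK.
rewrite mulrAC ler_pdivrMr// -mulrA ler_wpM2l// ?(ltW k0)// mulrC.
apply: le_trans (mdot_mxvec_le V) _; rewrite -/N.
by apply: ler_wpM2r; [exact: sqr_ge0|rewrite lerDl].
Qed.
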